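(* Let $T$ be a supercritical Galton-Watson tree with respect to a similarity IFS $\Phi=\{\varphi_i\}_{i\in\Lambda}$, and let $E$ be the corresponding Galton-Watson fractal. Then $$\mathrm{supp}(E)=\Gamma_\Phi(\mathrm{supp}(\mathcal{G}'))=\Gamma_\Phi(\mathrm{supp}(\mathcal{G}^\infty)),$$ and almost surely conditioned on non-extinction, $$\mathrm{supp}(E)=\overline{\mathcal{S}_\Phi^{T'}}.$$
   Context: A similarity IFS is a finite non-empty collection $\Phi=\{\varphi_i\}_{i\in\Lambda}$ of contracting similarity maps of $\mathbb{R}^d$ (maps with $\|\varphi_i(x)-\varphi_i(y)\|=r_i\|x-y\|$, $0<r_i<1$), with attractor $K$. The coding map is $\gamma_\Phi(i)=\lim_{n}\varphi_{i_1}\circ\dots\circ\varphi_{i_n}(0)$ for $i\in\Lambda^{\mathbb{N}}$. A tree with alphabet $\Lambda$ is a set $S\subseteq\Lambda^*=\bigcup_{n\ge0}\Lambda^n$ containing the empty word and closed under taking prefixes; $S_n=S\cap\Lambda^n$; $\partial S=\{i\in\Lambda^{\mathbb{N}}: i_1\dots i_n\in S\ \forall n\}$; for $v\in S$, $S^v=\{w\in\Lambda^*: vw\in S\}$. The set $\mathcal{T}_\Lambda$ of all trees carries the metric $d(T,S)=2^{-\min\{n: T_n\ne S_n\}}$. $\mathcal{T}^\infty_\Lambda$ is the subspace of infinite trees and $\mathcal{T}'_\Lambda$ the subspace of trees without leaves (every node has a child in the tree). For $S\in\mathcal{T}^\infty_\Lambda$, the reduced tree is $S'=\{v\in S: S^v\text{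 is infinite}\}\in\mathcal{T}'_\Lambda$, and $\Gamma_\Phi(S)=\gamma_\Phi(\partial S)$. For $S\in\mathcal{T}'_\Lambda$, $\mathcal{S}_\Phi^S=\{\Gamma_\Phi(S^v): v\in S\}$ and $\overline{\mathcal{S}_\Phi^S}$ is its closure in the Hausdorff metric. Let $W$ be a random variable with values in $2^\Lambda$ and $(W_a)_{a\in\Lambda^*}$ independent copies of $W$. The Galton-Watson tree $T=\bigcup_{n\ge0}T_n$ is defined by $T_0=\{\emptyset\}$ (the empty word) and $T_n=\bigcup_{a\in T_{n-1}}\{aj: j\in W_a\}$. Supercritical means $\mathbb{E}(|W|)>1$; non-extinction is the event that $T$ is infinite. $\mathcal{G}^\infty$ denotes the law of $T$ conditioned on non-extinction (a Borel measure on $\mathcal{T}^\infty_\Lambda$) and $\mathcal{G}'$ the law of $T'$ conditioned on non-extinction (a Borel measure on $\mathcal{T}'_\Lambda$). Supports are taken in $\mathcal{T}_\Lambda^\infty$ and $\mathcal{T}'_\Lambda$ respectively. The Galton-Watson fractal $E$ is the random set $\Gamma_\Phi(T)$ conditioned on non-extinction, and $\mathrm{supp}(E)$ is the support of its distribution on the space of non-empty compact subsets of $K$ with the Hausdorff metric. *)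

(* Defs.v *)
From HB Require Import structures.
From mathcomp Require Import all_boot all_order all_algebra.
From mathcomp Require Import all_classical all_reals all_analysis.
Set Implicit Arguments.
Unset Strict Implicit.
Unset Printing Implicit Defensive.
Import Order.TTheory GRing.Theory Num.Theory.
Import numFieldNormedType.Exports.
Local Open Scope classical_set_scope.
Local Open Scope ring_scope.

Section MetricSpaces.
Context {R : realType} {T : Type}.
Implicit Types (X A : set T) (dist : T -> T -> R).

(* A metric space is given by its carrier [X] inside an ambient type and a
   distance that is only meaningful on [X]. *)

Definition mball X dist (x : T) (e : R) : set T := [set y | X y /\ dist x y < e].

Definition mclosure X dist A : set T :=
  [set x | X x /\ forall e, 0 < e -> mball X dist x e `&` A !=set0].

(* [mu] is a Borel measure on [X], only evaluated on balls here. *)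
Definition msupport X dist (mu : set T -> \bar R) : set T :=
  [set x | X x /\ forall e, 0 < e -> (0 < mu (mball X dist x e))%E].

End MetricSpaces.

Section Similarities.
Context {R : realType} {d : nat}.
Implicit Types (x y : 'rV[R]_d) (A B : set 'rV[R]_d).

(* The library norm on row vectors is the sup norm; similarities and the
   Hausdorff metric refer to the Euclidean one, which induces the same
   topology. *)
Definition enorm x : R := Num.sqrt (\sum_(i < d) x ord0 i ^+ 2).

Definition edistance x y : R := enorm (x - y).

Definition hausdorff_dist A B : R :=
  inf [set e | [/\ 0 <= e,
    forall a, A a -> exists2 b, B b & edistance a b <= e &
    forall b, B b -> exists2 a, A a & edistance a b <= e]].

Definition nonempty_compacts_in (K : set 'rV[R]_d) : set (set 'rV[R]_d) :=
  [set A | [/\ A !=set0, compact A & A `<=` K]].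

Definition contracting_similarity (f : 'rV[R]_d -> 'rV[R]_d) : Prop :=
  exists r : R, 0 < r < 1 /\
    forall x y, edistance (f x) (f y) = r * edistance x y.

Context {Lambda : finType}.

Definition similarity_IFS (phi : Lambda -> 'rV[R]_d -> 'rV[R]_d) : Prop :=
  (0 < #|Lambda|)%N /\ forall i, contracting_similarity (phi i).

Definition is_attractor (phi : Lambda -> 'rV[R]_d -> 'rV[R]_d)
    (K : set 'rV[R]_d) : Prop :=
  [/\ K !=set0, compact K & K = \bigcup_(i in [set: Lambda]) (phi i @` K)].

Definition coding (phi : Lambda -> 'rV[R]_d -> 'rV[R]_d) (w : nat -> Lambda) :
    'rV[R]_d :=
  limn (fun n => foldr phi 0 (mkseq w n)).

End Similarities.

Section Trees.
Context {Lambda : finType}.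
Implicit Types S : set (seq Lambda).

Definition is_tree S : Prop :=
  S [::] /\ forall u v, S (u ++ v) -> S u.

Definition level S (n : nat) : set (seq Lambda) :=
  [set v | S v /\ size v = n].

Definition boundary S : set (nat -> Lambda) :=
  [set w | forall n, S (mkseq w n)].

Definition subtree S (v : seq Lambda) : set (seq Lambda) :=
  [set w | S (v ++ w)].

Definition infinite_trees : set (set (seq Lambda)) :=
  [set S | is_tree S /\ infinite_set S].

Definition leafless_trees : set (set (seq Lambda)) :=
  [set S | is_tree S /\ forall v, S v -> exists j, S (rcons v j)].

Definition reduced S : set (seq Lambda) :=
  [set v | S v /\ infinite_set (subtree S v)].

Definition tree_dist {R : realType} (S T : set (seq Lambda)) : R :=
  if pselect (exists n, `[< level S n <> level T n >]) is left h
  then 2^-1 ^+ ex_minn h else 0.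

Definition Gamma {R : realType} {d : nat}
    (phi : Lambda -> 'rV[R]_d -> 'rV[R]_d) S : set 'rV[R]_d :=
  coding phi @` boundary S.

Definition descendants {R : realType} {d : nat}
    (phi : Lambda -> 'rV[R]_d -> 'rV[R]_d) S : set (set 'rV[R]_d) :=
  [set Gamma phi (subtree S v) | v in S].

Fixpoint GW_level (W : seq Lambda -> {set Lambda}) (n : nat) :
    set (seq Lambda) :=
  if n is m.+1 then
    \bigcup_(a in GW_level W m) [set rcons a j | j in [set j | j \in W a]]
  else [set [::]].

Definition GW_tree (W : seq Lambda -> {set Lambda}) : set (seq Lambda) :=
  \bigcup_n GW_level W n.

End Trees.

Section Probability.
Context {R : realType} {dO : measure_display} {Omega : measurableType dO}.
Variable P : probability Omega R.

(* Random variables with values in a finite set carrying the discrete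
   sigma-algebra. *)
Definition discrete_rv {F : finType} (X : Omega -> F) : Prop :=
  forall B : set F, measurable (X @^-1` B).

Definition mutually_independent {I : eqType} {F : finType}
    (X : I -> Omega -> F) : Prop :=
  forall (s : seq I) (B : I -> set F), uniq s ->
    P (\bigcap_(i in [set` s]) (X i @^-1` B i)) =
    (\prod_(i <- s) P (X i @^-1` B i))%E.

Definition independent_copies {I : eqType} {F : finType}
    (Y : Omega -> F) (X : I -> Omega -> F) : Prop :=
  [/\ forall i, discrete_rv (X i),
      forall i (B : set F), P (X i @^-1` B) = P (Y @^-1` B) &
      mutually_independent X].

(* Law of [X] under [P] conditioned on the event [N]. *)
Definition cond_law {T : Type} (N : set Omega) (X : Omega -> T) :
    set T -> \bar R :=
  fun A => (P (N `&` X @^-1` A) / P N)%E.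

Context {Lambda : finType}.
Variable W : seq Lambda -> Omega -> {set Lambda}.

Definition GW (w : Omega) : set (seq Lambda) := GW_tree (fun a => W a w).

Definition nonextinction : set Omega := [set w | infinite_set (GW w)].

Definition law_Ginf : set (set (seq Lambda)) -> \bar R :=
  cond_law nonextinction GW.

Definition law_Gprime : set (set (seq Lambda)) -> \bar R :=
  cond_law nonextinction (fun w => reduced (GW w)).

Definition supp_Ginf : set (set (seq Lambda)) :=
  msupport infinite_trees (@tree_dist Lambda R) law_Ginf.

Definition supp_Gprime : set (set (seq Lambda)) :=
  msupport leafless_trees (@tree_dist Lambda R) law_Gprime.

Definition supp_E {d : nat} (phi : Lambda -> 'rV[R]_d -> 'rV[R]_d)
    (K : set 'rV[R]_d) : set (set 'rV[R]_d) :=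
  msupport (nonempty_compacts_in K) hausdorff_dist
    (cond_law nonextinction (fun w => Gamma phi (GW w))).

End Probability.

(* Main.v *)
Require Import Defs.
From HB Require Import structures.
From mathcomp Require Import all_boot all_order all_algebra.
From mathcomp Require Import all_classical all_reals all_analysis.
From mathcomp Require Import measurable_realfun.
Set Implicit Arguments.
Unset Strict Implicit.
Unset Printing Implicit Defensive.
Import Order.TTheory GRing.Theory Num.Theory.
Import numFieldNormedType.Exports.
Local Open Scope classical_set_scope.
Local Open Scope ring_scope.

(* The offspring law decides both supports. A tree S without leaves lies in
   supp(G') iff at each v in S some offspring set of positive probability
   contains the children of v in S and the superfluous children can die out;
   an infinite tree lies in supp(G^infty) iff each of its vertices has an
   offspring set of positive probability. Both facts, and the measurability of
   all events involved, come from the branching property at the root.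
   Pruning and adding dying siblings exchange the two kinds of trees without
   changing the boundary, whence Gamma(supp G') = Gamma(supp G^infty). Gamma is
   uniformly continuous on trees without leaves, and supp(G') is compact, so
   Gamma(supp G') is closed and equals supp(E).
   For the last claim fix an event C of positive probability that forces
   survival. The probability g that no subtree of T satisfies C obeys g <= f(g)
   for the offspring generating function f, while the extinction probability q
   obeys q = f(q) and q <= g < 1. Since f is convex, and strictly so as
   E|W| > 1, this forces g = q: almost every infinite T has a subtree in C.
   Applied to the countably many patterns of T' on finitely many levels, this
   gives the density of the descendants of T' in supp(E). *)

(** * Trees *)

Section Trees.
Context {Lambda : finType}.
Implicit Types (S : set (seq Lambda)) (u v : seq Lambda) (j : Lambda)
  (w : nat -> Lambda) (e : seq Lambda -> {set Lambda}).

(** Trees are treated as deterministic functions of an assignment [e] of offspring sets to words.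
    The shift is the assignment seen from [v]; it drives the subtree of descendants of [v]. *)
Definition env_shift v e : seq Lambda -> {set Lambda} := fun a => e (v ++ a).

Lemma GW_tree_nil e : GW_tree e [::].
Proof. by exists 0%N. Qed.

Lemma GW_tree_rcons e v j : GW_tree e (rcons v j) <-> GW_tree e v /\ j \in e v.
Proof.
split.
- case=> -[_ /=|n _ [a an [i ie]]]; first by case: v.
  by move=> /eqP; rewrite eqseq_rcons => /andP[/eqP <- /eqP <-]; split=> //; exists n.
- by move=> [[n _ vn] je]; exists n.+1 => //; exists v => //; exists j.
Qed.

Lemma GW_tree_cat e u v :
  GW_tree e (u ++ v) <-> GW_tree e u /\ GW_tree (env_shift u e) v.
Proof.
elim/last_ind: v => [|v j IH].
  by rewrite cats0; split=> [?|[]//]; split=> //; exact: GW_tree_nil.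
rewrite -rcons_cat !GW_tree_rcons IH /env_shift; tauto.
Qed.

Lemma GW_tree1 e j : GW_tree e [:: j] <-> j \in e [::].
Proof.
rewrite -[[:: j]]/(rcons [::] j) GW_tree_rcons; split=> [[]//|]; split=> //.
exact: GW_tree_nil.
Qed.

Lemma GW_tree_cons e j v :
  GW_tree e (j :: v) <-> j \in e [::] /\ GW_tree (env_shift [:: j] e) v.
Proof. by rewrite -cat1s GW_tree_cat GW_tree1. Qed.

Lemma GW_tree_is_tree e : is_tree (GW_tree e).
Proof. by split=> [|u v /GW_tree_cat[]//]; exact: GW_tree_nil. Qed.

Lemma subtree_GW_tree e v :
  GW_tree e v -> subtree (GW_tree e) v = GW_tree (env_shift v e).
Proof.
by move=> ev; apply/seteqP; split=> u; rewrite /subtree /= GW_tree_cat; tauto.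
Qed.

Lemma subtree_nil S : subtree S [::] = S.
Proof. by []. Qed.

Lemma subtree_cat S u v : subtree S (u ++ v) = subtree (subtree S u) v.
Proof. by apply/seteqP; split=> x; rewrite /subtree /= catA. Qed.

Lemma env_shift_cat u v e : env_shift (u ++ v) e = env_shift v (env_shift u e).
Proof. by apply/funext => a; rewrite /env_shift catA. Qed.

Lemma finite_size_le n : finite_set [set v : seq Lambda | (size v <= n)%N].
Proof.
have -> : [set v : seq Lambda | (size v <= n)%N] =
    (@bseqval n Lambda) @` [set: n.-bseq Lambda].
  apply/seteqP; split=> v /=; last by case=> b _ <-; exact: size_bseq.
  by move=> vn; exists (Bseq vn).
exact: finite_image.
Qed.

Lemma is_tree_prefix S u v : is_tree S -> S (u ++ v) -> S u.
Proof. by case=> _; apply. Qed.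

Lemma is_tree_subtree S v : is_tree S -> S v -> is_tree (subtree S v).
Proof.
move=> St Sv; split; first by rewrite /subtree /= cats0.
by move=> a b; rewrite /subtree /= catA; exact: is_tree_prefix.
Qed.

(** The alphabet is finite, so an infinite tree has arbitrarily long words, and truncation gives
    every shorter length. This turns survival into countably many conditions. *)
Lemma infinite_treeP S : is_tree S ->
  infinite_set S <-> forall n, exists2 v, S v & size v = n.
Proof.
move=> St; split=> [Soo n|Sall Sfin].
- apply: contrapT => none; apply: Soo.
  apply: sub_finite_set (finite_size_le n) => v Sv /=.
  rewrite leqNgt; apply/negP => nv; apply: none; exists (take n v).
    by apply: (@is_tree_prefix _ _ (drop n v)); rewrite // cat_take_drop.
  by rewrite size_takel // ltnW.
- have [s Ss] := (finite_seqP _).1 Sfin.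
  (* This length exceeds the length of every word in the finite list. *)
  have [v Sv sv] := Sall (\sum_(x <- s) size x).+1.
  have : v \in s by rewrite Ss in Sv.
  move=> vs; have := leqnn (size v).
  by rewrite {1}sv (big_rem _ vs) /= ltnNge leq_addr.
Qed.

Lemma infinite_child S : is_tree S -> infinite_set S ->
  exists2 j, S [:: j] & infinite_set (subtree S [:: j]).
Proof.
move=> St Soo; apply: contrapT => none; apply: Soo.
pose F := [set [::]] `|`
  \bigcup_(j in [set: Lambda]) (cons j @` (subtree S [:: j])).
apply: (@sub_finite_set _ _ F) => [[|j v] Sv|]; [by left| |].
  by right; exists j => //; exists v.
rewrite /F finite_setU; split; first exact: finite_set1.
apply: bigcup_finite => [|j _]; first exact: finite_finset.
apply: finite_image; apply: contrapT => Sj; apply: none; exists j => //.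
by have [v] := infinite_setN0 Sj; exact: (@is_tree_prefix _ [:: j] v).
Qed.

Lemma reduced_leafless S : is_tree S -> infinite_set S ->
  leafless_trees (reduced S).
Proof.
move=> St Soo; split; first split.
- by split; [exact: St.1|rewrite subtree_nil].
- move=> u v [Suv Suvoo]; split; first exact: is_tree_prefix Suv.
  move=> fin; apply: Suvoo; rewrite subtree_cat.
  apply: (@sub_finite_set _ _ (drop (size v) @` subtree S u)); last exact: finite_image.
  by move=> x ux; exists (v ++ x) => //; rewrite drop_size_cat.
- move=> v [Sv Svoo].
  have [j Sj Sjoo] := infinite_child (is_tree_subtree St Sv) Svoo.
  exists j; rewrite -cats1; split=> //.
  by rewrite subtree_cat.
Qed.

(** Follow [v] to its end, then keep choosing a child. *)
Lemma leafless_branch S v : leafless_trees S -> S v ->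
  exists2 w, boundary S w & mkseq w (size v) = v.
Proof.
move=> [St leafless] Sv.
have [j0 _] := leafless _ St.1.
have /choice[f fP] : forall u, exists j, S u -> S (rcons u j).
  move=> u; have [/leafless[j Sj]|nSu] := pselect (S u); first by exists j.
  by exists j0 => /nSu.
(* The next letter after [u]: read from [v] while [u] is shorter, chosen by [f] afterwards. The
   letter [j0] is only a default value. *)
pose g u := if (size u < size v)%N then nth j0 v (size u) else f u.
pose b := fix b n := if n is m.+1 then rcons (b m) (g (b m)) else [::].
pose w n := g (b n).
have wb n : mkseq w n = b n by elim: n => // n IH; rewrite mkseqS IH.
have sb n : size (b n) = n by rewrite -wb size_mkseq.
have btake n : (n <= size v)%N -> b n = take n v.
  elim: n => [|n IH] nv; first by rewrite take0.
  by rewrite /= IH ?(ltnW nv)// /g size_takel ?(ltnW nv)// nv -take_nth.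
exists w; last by rewrite wb btake // take_size.
move=> n; rewrite wb; elim: n => [|n IH]; first exact: St.1.
have [nv|vn] := leqP n.+1 (size v).
  rewrite btake//; apply: (@is_tree_prefix _ _ (drop n.+1 v)) => //.
  by rewrite cat_take_drop.
by rewrite /= /g sb ltnNge (vn : size v <= n)%N /=; exact: fP.
Qed.

Lemma mkseqD w m n : mkseq w (m + n) = mkseq w m ++ mkseq (fun i => w (m + i)%N) n.
Proof.
elim: n => [|n IH]; first by rewrite addn0 cats0.
by rewrite addnS !mkseqS IH rcons_cat.
Qed.

(** Every node on an infinite branch has the rest of the branch below it, so it survives the
    reduction. *)
Lemma boundary_reduced S : is_tree S -> boundary (reduced S) = boundary S.
Proof.
move=> St; apply/seteqP; split=> w Sw n; first by case: (Sw n).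
split=> //; apply/(infinite_treeP (is_tree_subtree St (Sw n))) => m.
exists (mkseq (fun i => w (n + i)%N) m); last by rewrite size_mkseq.
by rewrite /subtree /= -mkseqD.
Qed.

Lemma leafless_infinite S : leafless_trees S -> infinite_set S.
Proof.
move=> Sl; have [w Sw _] := leafless_branch Sl Sl.1.1.
by apply/(infinite_treeP Sl.1) => n; exists (mkseq w n); rewrite ?size_mkseq.
Qed.

Lemma leafless_subtree S v : leafless_trees S -> S v ->
  leafless_trees (subtree S v).
Proof.
move=> [St Sl] Sv; split; first exact: is_tree_subtree.
by move=> u /Sl[j] Sj; exists j; rewrite /subtree /= -rcons_cat.
Qed.

Lemma reduced_subtree S v : subtree (reduced S) v = reduced (subtree S v).
Proof.
by apply/seteqP; split=> u; rewrite /subtree/reduced /= -/(subtree S v) -subtree_cat.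
Qed.

(** Without leaves each node of level [k] has a descendant at level [n], so one level determines all
    earlier ones. *)
Lemma leafless_level_prefix S T k n : leafless_trees S -> leafless_trees T ->
  (k <= n)%N -> level S n = level T n -> level S k `<=` level T k.
Proof.
move=> Sl Tl kn ST v [Sv vk]; split=> //.
have [w Sw wv] := leafless_branch Sl Sv.
have : level S n (mkseq w n) by split; rewrite ?size_mkseq.
rewrite ST -wv vk => -[Twn _].
by move: Twn; rewrite -(subnKC kn) mkseqD; exact: is_tree_prefix Tl.1.
Qed.

Lemma leafless_level_eq S T k n : leafless_trees S -> leafless_trees T ->
  (k <= n)%N -> level S n = level T n -> level S k = level T k.
Proof.
move=> Sl Tl kn ST; apply/seteqP.
by split; apply: leafless_level_prefix kn _ => //; exact: esym.
Qed.

Lemma finite_level S n : finite_set (level S n).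
Proof.
by apply: sub_finite_set (finite_size_le n) => v [_ /= ->].
Qed.

Lemma level_seq S n : exists l : seq (seq Lambda), level S n = [set` l].
Proof. exact/finite_seqP/finite_level. Qed.

Lemma level_tree S T n v : (forall k, (k <= n)%N -> level S k = level T k) ->
  (size v <= n)%N -> S v -> T v.
Proof.
by move=> ST vn Sv; have : level S (size v) v by []; rewrite ST// => -[].
Qed.

Lemma finite_tree_leaf S : is_tree S -> finite_set S ->
  exists2 v, S v & forall j, ~ S (rcons v j).
Proof.
move=> St Sfin; apply: contrapT => none; apply: leafless_infinite Sfin.
split=> // v Sv; apply: contrapT => nj; apply: none.
by exists v => // j Sj; apply: nj; exists j.
Qed.

(** A finite set, so that it can be compared with values of the offspring variable. *)
Definition children S v : {set Lambda} := [set j | `[< S (rcons v j) >]].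

Lemma in_children S v j : (j \in children S v) <-> S (rcons v j).
Proof. by rewrite inE; split=> /asboolP. Qed.

Lemma children_GW_tree e v : GW_tree e v -> children (GW_tree e) v = e v.
Proof.
move=> ev; apply/setP => j; apply/idP/idP.
  by move=> /in_children /GW_tree_rcons[].
by move=> je; apply/in_children/GW_tree_rcons.
Qed.

(** * Balls of the tree metric as agreement on finitely many levels *)

Section TreeDistance.
Context {R : realType}.

Lemma tree_dist_ltP (eps : R) : 0 < eps -> exists n, forall S T,
  tree_dist S T < eps <-> forall k, (k < n)%N -> level S k = level T k.
Proof.
move=> eps0.
have ex : exists n, 2^-1 ^+ n < eps :> R.
  have /cvgr_lt/(_ _ eps0)[n _ nP] : (fun n => 2^-1 ^+ n : R) @ \oo --> (0 : R).
    by apply: cvg_expr; rewrite ger0_norm ?invr_ge0 ?ler0n// invf_lt1 ?ltr1n ?ltr0n.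
  by exists n; apply: (nP n) => /=.
(* The least exponent with [2^-1 ^+ n < eps]: the distance is below [eps] exactly when the first
   differing level, if any, is at least [n]. *)
pose n := ex_minn ex.
exists n => S T; rewrite /n; case: ex_minnP => {}n npos nmin.
rewrite /tree_dist; case: pselect => [h|none]; last first.
  split=> // _ k _; apply: contrapT => ST; apply: none; exists k.
  exact/asboolP.
case: ex_minnP => m /asboolP STm mmin; split=> [/nmin nm k kn|ST].
  apply: contrapT => /asboolP/mmin; rewrite leqNgt => /negP; apply.
  exact: leq_trans kn nm.
apply: le_lt_trans npos; rewrite ler_wiXn2l ?invr_ge0 ?invf_le1 ?ler0n ?ltr0n ?ler1n//.
by rewrite leqNgt; apply/negP => /ST.
Qed.

Lemma tree_dist_lt_level n S T : tree_dist S T < 2^-1 ^+ n :> R ->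
  forall k, (k <= n)%N -> level S k = level T k.
Proof.
rewrite /tree_dist; case: pselect => [h|none _ k _]; last first.
  by apply: contrapT => ST; apply: none; exists k; exact/asboolP.
case: ex_minnP => m /asboolP STm mmin.
rewrite ltr_iXn2l ?invr_gt0 ?invf_lt1 ?ltr0n ?ltr1n// => nm k kn.
apply: contrapT => /asboolP/mmin; rewrite leqNgt => /negP; apply.
exact: leq_ltn_trans kn nm.
Qed.

End TreeDistance.

End Trees.

(** This replaces the extraction of a diagonal subsequence. An ultrafilter finer than the cofinite
    filter selects one value per coordinate because [F] is finite, and finitely many selections hold
    together for arbitrarily large [k]. *)
Lemma ultralimit (I : eqType) (F : finType) (x : nat -> I -> F) :
  exists y : I -> F, forall (s : seq I) k0, exists2 k, (k0 <= k)%N &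
    {in s, x k =1 y}.
Proof.
have [U [UU ooU]] := @ultraFilterLemma nat \oo _.
have UF : ProperFilter U := ultra_proper.
have pt i : exists j, U [set k | x k i = j].
  apply: contrapT => none.
  suff /filter_ex[k /(_ (x k i))//] : U [set k | forall j, x k i <> j].
    apply: filter_forall => j.
    by have [xj|//] := in_ultra_setVsetC [set k | x k i = j] UU; case: none; exists j.
have [y yP] := choice pt.
exists y => s k0.
have : U [set k | (k0 <= k)%N /\ {in s, x k =1 y}].
  elim: s => [|i s IH].
    by apply: filterS (ooU _ (nbhs_infty_ge k0)) => k /= ?; split.
  apply: filterS2 IH (yP i) => k [k0k ks] xki; split=> // a.
  by rewrite inE => /orP[/eqP ->//|]; exact: ks.
by move=> /filter_ex[k [? ?]]; exists k.
Qed.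

(** * Euclidean geometry and the coding map *)

Section Euclid.
Context {R : realType} {d : nat}.
Implicit Types x y z : 'rV[R]_d.

Let sq x := \sum_(i < d) x ord0 i ^+ 2.

Let sq_ge0 x : 0 <= sq x.
Proof. by apply: sumr_ge0 => i _; exact: sqr_ge0. Qed.

Lemma enorm_ge0 x : 0 <= enorm x.
Proof. exact: sqrtr_ge0. Qed.

Lemma enormN x : enorm (- x) = enorm x.
Proof. by rewrite /enorm; congr Num.sqrt; apply: eq_bigr => i _; rewrite mxE sqrrN. Qed.

Lemma edistance_ge0 x y : 0 <= edistance x y.
Proof. exact: enorm_ge0. Qed.

Lemma edistanceC x y : edistance x y = edistance y x.
Proof. by rewrite /edistance -enormN opprB. Qed.

Lemma coord_le_normr x i : `|x ord0 i| <= `|x|.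
Proof.
rewrite [leRHS]/Num.norm /= mx_normrE.
by apply/bigmax_geP; right => /=; exists (ord0, i).
Qed.

Lemma normr_le_enorm x : `|x| <= enorm x.
Proof.
rewrite [leLHS]/Num.norm /= mx_normrE.
apply: bigmax_le => [|[j i] _]; first exact: enorm_ge0.
rewrite /= ord1 -sqrtr_sqr ler_sqrt//; last exact: sq_ge0.
by rewrite (bigD1 i)//= lerDl sumr_ge0// => k _; exact: sqr_ge0.
Qed.

Lemma enorm_le_normr x : enorm x <= Num.sqrt d%:R * `|x|.
Proof.
rewrite -[X in _ * X](ger0_norm (normr_ge0 x)) -sqrtr_sqr -sqrtrM ?ler0n//.
rewrite ler_sqrt; last by rewrite mulr_ge0 ?sqr_ge0 ?ler0n.
have -> : d%:R * `|x| ^+ 2 = \sum_(i < d) `|x| ^+ 2.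
  by rewrite sumr_const card_ord mulr_natl.
apply: ler_sum => i _; rewrite -[x ord0 i ^+ 2]real_normK ?num_real//.
by rewrite lerXn2r ?nnegrE ?coord_le_normr.
Qed.

(** For nonzero vectors, expand the squared norm of [enorm y * x - enorm x * y], which is
    nonnegative, and cancel [enorm x * enorm y]. *)
Lemma cauchy_schwarz x y :
  \sum_(i < d) x ord0 i * y ord0 i <= enorm x * enorm y.
Proof.
have sqE z : enorm z ^+ 2 = sq z by rewrite sqr_sqrtr//; exact: sq_ge0.
have [x0|x0] := eqVneq (enorm x) 0.
  rewrite x0 mul0r big1// => i _.
  have := le_trans (coord_le_normr x i) (normr_le_enorm x).
  by rewrite x0 normr_le0 => /eqP ->; rewrite mul0r.
have [y0|y0] := eqVneq (enorm y) 0.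
  rewrite y0 mulr0 big1// => i _.
  have := le_trans (coord_le_normr y i) (normr_le_enorm y).
  by rewrite y0 normr_le0 => /eqP ->; rewrite mulr0.
have xy0 : 0 < enorm x * enorm y by rewrite mulr_gt0// lt0r ?x0 ?y0 enorm_ge0.
rewrite -(ler_pM2l xy0).
have : 0 <= \sum_(i < d) (enorm y * x ord0 i - enorm x * y ord0 i) ^+ 2.
  by apply: sumr_ge0 => i _; exact: sqr_ge0.
have -> : \sum_(i < d) (enorm y * x ord0 i - enorm x * y ord0 i) ^+ 2 =
    enorm y ^+ 2 * sq x + enorm x ^+ 2 * sq y -
    (enorm x * enorm y * \sum_(i < d) x ord0 i * y ord0 i) *+ 2.
  rewrite /sq !mulr_sumr -sumrMnl -sumrN -!big_split /=.
  apply: eq_bigr => i _.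
  by rewrite sqrrB !exprMn addrAC [enorm y * x _ _ * _]mulrACA (mulrC (enorm y) (enorm x)).
rewrite -!sqE subr_ge0 (mulrC (enorm y ^+ 2)) -exprMn -mulr2n.
by rewrite ler_pMn2r.
Qed.

Lemma ler_enormD x y : enorm (x + y) <= enorm x + enorm y.
Proof.
rewrite -(@ler_pXn2r _ 2)// ?nnegrE ?addr_ge0 ?enorm_ge0//.
rewrite sqrrD !sqr_sqrtr ?sq_ge0//.
have -> : \sum_(i < d) (x + y) ord0 i ^+ 2 =
    sq x + (\sum_(i < d) x ord0 i * y ord0 i) *+ 2 + sq y.
  rewrite /sq -sumrMnl -!big_split /=.
  by apply: eq_bigr => i _; rewrite mxE sqrrD.
by rewrite lerD2r lerD2l ler_pMn2r// cauchy_schwarz.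
Qed.

Lemma edistance_triangle y x z : edistance x z <= edistance x y + edistance y z.
Proof. by rewrite /edistance (le_trans _ (ler_enormD _ _))// addrA subrK. Qed.

Lemma compact_edistance_bounded (A : set 'rV[R]_d) : compact A ->
  exists2 M, 0 <= M & forall x, A x -> enorm x <= M.
Proof.
move=> /compact_bounded[M [_ MA]].
exists (Num.sqrt d%:R * (`|M| + 1)); first by rewrite mulr_ge0 ?sqrtr_ge0 ?addr_ge0.
move=> x Ax; apply: le_trans (enorm_le_normr x) _.
rewrite ler_wpM2l ?sqrtr_ge0//; apply: MA => //.
by rewrite (le_lt_trans (ler_norm M))// ltrDl.
Qed.

Lemma closed_approx (A : set 'rV[R]_d) x : closed A ->
  (forall e, 0 < e -> exists2 y, A y & edistance x y < e) -> A x.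
Proof.
move=> Acl xA; apply: Acl => B /nbhs_ballP[e /= e0 eB].
have [y Ay xye] := xA _ e0; exists y; split=> //; apply: eB.
by rewrite -ball_normE /=; exact: le_lt_trans (normr_le_enorm _) xye.
Qed.

Lemma hausdorff_dist_le (A B : set 'rV[R]_d) e : 0 <= e ->
  (forall a, A a -> exists2 b, B b & edistance a b <= e) ->
  (forall b, B b -> exists2 a, A a & edistance a b <= e) ->
  hausdorff_dist A B <= e.
Proof. by move=> e0 AB BA; apply: ge_inf => //; exists 0 => z []. Qed.

(** Boundedness makes some radius admissible, so the infimum is not the default value of an empty
    set, and an admissible radius below [e] exists. *)
Lemma hausdorff_dist_lt (A B : set 'rV[R]_d) e : A !=set0 -> B !=set0 ->
  compact A -> compact B -> hausdorff_dist A B < e ->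
  exists e', [/\ 0 <= e', e' < e,
    forall a, A a -> exists2 b, B b & edistance a b <= e' &
    forall b, B b -> exists2 a, A a & edistance a b <= e'].
Proof.
move=> [a0 Aa0] [b0 Bb0] /compact_edistance_bounded[M M0 AM].
move=> /compact_edistance_bounded[N N0 BN] /inf_lt[|e' [? ? ?] ?]; last by exists e'.
have ABMN a b : A a -> B b -> edistance a b <= M + N.
  move=> Aa Bb; apply: le_trans (ler_enormD _ _) _.
  by rewrite enormN lerD ?AM ?BN.
exists (M + N); split=> [|a Aa|b Bb]; first exact: addr_ge0.
- by exists b0 => //; exact: ABMN.
- by exists a0 => //; exact: ABMN.
Qed.

End Euclid.

(** * The coding map and the continuity of [Gamma] on leafless trees *)

Section Coding.
Context {R : realType} {d : nat} {Lambda : finType}.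
Variables (phi : Lambda -> 'rV[R]_d -> 'rV[R]_d) (K : set 'rV[R]_d).
Hypotheses (hphi : similarity_IFS phi) (hK : is_attractor phi K).
Implicit Types (S T : set (seq Lambda)) (w : nat -> Lambda).

Lemma IFS_ratio : exists rho : R, 0 < rho < 1 /\
  forall v x y, edistance (foldr phi x v) (foldr phi y v) <=
    rho ^+ size v * edistance x y.
Proof.
have /choice[r rP] := hphi.2.
(* The default [2^-1] of the maximum makes positivity immediate and stays below 1. *)
exists (\big[Num.max/2^-1]_i r i); split.
  rewrite (lt_le_trans _ (bigmax_ge_id _ _ _ _)) ?invr_gt0 ?ltr0n//=.
  apply: bigmax_lt => [|i _]; first by rewrite invf_lt1 ?ltr1n ?ltr0n.
  by have [/andP[]] := rP i.
elim=> [|i v IH] x y /=; first by rewrite expr0 mul1r.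
have [/andP[ri0 _] ->] := rP i.
rewrite exprS -mulrA ler_pM ?(ltW ri0) ?edistance_ge0//.
exact: (le_bigmax _ r i).
Qed.

Lemma foldr_attractor v x : K x -> K (foldr phi x v).
Proof.
by move=> Kx; elim: v => //= i v IH; have [_ _ ->] := hK; exists i => //; exists (foldr phi x v).
Qed.

(** Compositions along a branch contract geometrically, so their values at 0 form a Cauchy sequence.
    Its limit is also the limit of the orbit of a point [x] of [K], which stays in the closed set
    [K]. *)
Lemma coding_approx : exists2 C, 0 <= C & exists2 rho, 0 < rho < 1 &
  forall w, K (coding phi w) /\
    forall n, edistance (coding phi w) (foldr phi 0 (mkseq w n)) <= C * rho ^+ n.
Proof.
have [rho [/andP[rho0 rho1] contr]] := IFS_ratio.
have [[x Kx] Kcomp _] := hK.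
have [M M0 KM] := compact_edistance_bounded Kcomp.
(* The image of 0 under any composition is within [edistance 0 x] of the image of [x], and the
   latter has norm at most [M]. *)
pose D := edistance 0 x + M.
have D0 : 0 <= D by rewrite addr_ge0 ?edistance_ge0.
have vD v : edistance (foldr phi 0 v) (foldr phi x v) <= rho ^+ size v * D.
  apply: le_trans (contr _ _ _) _; rewrite ler_wpM2l ?exprn_ge0 ?(ltW rho0)//.
  by rewrite lerDl.
have boundD v : edistance (foldr phi 0 v) 0 <= D.
  apply: le_trans (edistance_triangle (foldr phi x v) _ _) _; apply: lerD.
    apply: le_trans (contr _ _ _) _.
    by rewrite ler_piMl ?edistance_ge0// exprn_ile1 ?(ltW rho0) ?(ltW rho1).
  by rewrite /edistance subr0; exact/KM/foldr_attractor.
have rhoD_to0 : (fun n => rho ^+ n * D) @ \oo --> (0 : R).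
  rewrite -[X in _ --> X](mul0r D); apply: cvgMl.
  by apply: cvg_expr; rewrite ger0_norm ?ltW.
(* The distance to the limit is estimated in the sup norm; [Num.sqrt d%:R] is the price for
   returning to the Euclidean norm. *)
exists (Num.sqrt d%:R * D); first by rewrite mulr_ge0 ?sqrtr_ge0.
exists rho => [|w]; first by rewrite rho0 rho1.
pose u n := foldr phi 0 (mkseq w n).
have uD n m : (n <= m)%N -> edistance (u m) (u n) <= rho ^+ n * D.
  move=> nm; rewrite /u -(subnKC nm) mkseqD foldr_cat.
  apply: le_trans (contr _ _ _) _; rewrite size_mkseq.
  by rewrite ler_wpM2l ?exprn_ge0 ?(ltW rho0).
have ucvg : u n @[n --> \oo] --> coding phi w.
  suff : cvgn u by [].
  apply: cauchy_cvg; apply: cauchy_exP => e e0.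
  have /cvgr_lt/(_ _ e0)[n _ nP] := rhoD_to0.
  exists (u n), n => // m nm; rewrite -ball_normE /= distrC.
  apply: le_lt_trans (normr_le_enorm _) _.
  exact: le_lt_trans (uD _ _ nm) (nP n (leqnn n)).
split.
  have Kcl : closed K by exact: compact_closed (@norm_hausdorff _ _) Kcomp.
  apply: (@closed_cvg _ _ (\oo : set_system nat) _ (fun n => foldr phi x (mkseq w n)) K Kcl) => [|].
    by apply: nearW => n; exact: foldr_attractor.
  have -> : (fun n => foldr phi x (mkseq w n)) =
      (fun n => u n + (foldr phi x (mkseq w n) - u n)).
    by apply/funext => n; rewrite addrC subrK.
  rewrite -[X in _ --> X]addr0; apply: cvgD => //.
  apply: norm_cvg0; apply: (@squeeze_cvgr _ _ _ _ (cst 0) (fun n => rho ^+ n * D)) => //.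
    apply: nearW => n; rewrite normr_ge0 /= distrC.
    apply: le_trans (normr_le_enorm _) _.
    by have := vD (mkseq w n); rewrite size_mkseq.
  exact: cvg_cst.
move=> n; apply: le_trans (enorm_le_normr _) _.
rewrite -mulrA ler_wpM2l ?sqrtr_ge0// mulrC.
have : (fun m => `|u m - u n|) @ \oo --> `|coding phi w - u n|.
  by apply: cvg_norm; apply: cvgB => //; exact: cvg_cst.
move=> cvgu; rewrite -(cvg_lim _ cvgu)//; apply: limr_le; first exact: cvgP cvgu.
near=> m; apply: le_trans (normr_le_enorm _) _; apply: uD.
by near: m; exact: nbhs_infty_ge.
Unshelve. all: by end_near. Qed.

Lemma coding_prefix : exists2 C, 0 <= C & exists2 rho, 0 < rho < 1 &
  forall w w' n, mkseq w n = mkseq w' n ->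
    edistance (coding phi w) (coding phi w') <= C * rho ^+ n.
Proof.
have [C C0 [rho rho01 CP]] := coding_approx.
exists (C * 2); first by rewrite mulr_ge0.
exists rho => // w w' n ww'.
apply: le_trans (edistance_triangle (foldr phi 0 (mkseq w n)) _ _) _.
rewrite mulrAC mulr_natr mulr2n lerD ?(CP w).2// ww' edistanceC.
exact: (CP w').2.
Qed.

Lemma coding_uniform (e : R) : 0 < e -> exists n, forall w w',
  mkseq w n = mkseq w' n -> edistance (coding phi w) (coding phi w') < e.
Proof.
move=> e0; have [C C0 [rho /andP[rho0 rho1] CP]] := coding_prefix.
have to0 : (fun n => C * rho ^+ n) @ \oo --> (0 : R).
  rewrite -[X in _ --> X](mulr0 C); apply: cvgMr.
  by apply: cvg_expr; rewrite ger0_norm ?ltW.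
have /cvgr_lt/(_ _ e0)[n _ nP] := to0.
exists n => w w' /CP/le_lt_trans; apply; exact: nP (leqnn n).
Qed.

Lemma Gamma_reduced S : is_tree S -> Gamma phi (reduced S) = Gamma phi S.
Proof. by move=> St; rewrite /Gamma boundary_reduced. Qed.

(** A branch of [S] meets level [n] in a node that also lies in [T], and there it extends to a
    branch of [T] with the same prefix. The level [n] depends on [e] alone. *)
Lemma Gamma_level (e : R) : 0 < e -> exists n, forall S T,
  leafless_trees S -> leafless_trees T -> level S n = level T n ->
  forall a, Gamma phi S a -> exists2 b, Gamma phi T b & edistance a b < e.
Proof.
move=> e0; have [n nP] := coding_uniform e0.
exists n => S T Sl Tl ST _ [w Sw <-].
have : level S n (mkseq w n) by split; rewrite ?size_mkseq.
rewrite ST => -[/(leafless_branch Tl)[w' Tw' ww'] _].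
rewrite size_mkseq in ww'.
by exists (coding phi w'); [exists w'|exact/nP/esym].
Qed.

(** Branches coding points near [p] have an ultralimit. Its prefixes are prefixes of these branches,
    so it lies in the boundary, and uniform continuity of the coding map makes it code [p]. *)
Lemma Gamma_closed S : closed (Gamma phi S).
Proof.
move=> p pS.
have /choice[x xP] k : exists w, boundary S w /\ edistance p (coding phi w) < k.+1%:R^-1.
  (* A sup-norm radius small enough for the Euclidean one; the [+ 1] keeps the denominator positive
     when [d] is 0. *)
  have k0 : 0 < k.+1%:R^-1 / (Num.sqrt d%:R + 1) :> R.
    by rewrite divr_gt0 ?invr_gt0 ?ltr0n// ltr_wpDl ?sqrtr_ge0.
  have [_ [[w Sw <-] pw]] := pS _ (nbhsx_ballx p _ k0).
  exists w; split=> //; apply: le_lt_trans (enorm_le_normr _) _.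
  rewrite -ball_normE /= ltr_pdivlMr ?ltr_wpDl ?sqrtr_ge0// in pw.
  apply: le_lt_trans pw; rewrite mulrC ler_wpM2l// lerDl ler01//.
have [w wP] := ultralimit x.
exists w.
  move=> n; have [k _ kw] := wP (iota 0 n) 0%N.
  have -> : mkseq w n = mkseq (x k) n by apply/esym/eq_in_map => i /kw.
  exact: (xP k).1.
suff : `|coding phi w - p| <= 0 by rewrite normr_le0 subr_eq0 => /eqP.
apply/ler_addgt0Pl => e e0; rewrite addr0.
have e20 : 0 < e / 2 by rewrite divr_gt0.
have [n nP] := coding_uniform e20.
have [k0 _ k0P] := near_infty_natSinv_lt (PosNum e20).
have [k k0k kw] := wP (iota 0 n) k0.
have kwn : mkseq w n = mkseq (x k) n by apply/esym/eq_in_map => i /kw.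
apply: le_trans (normr_le_enorm _) _.
apply: le_trans (edistance_triangle (coding phi (x k)) _ _) _.
rewrite [leRHS]splitr ltW// ltrD ?nP// edistanceC.
exact: lt_trans (xP k).2 (k0P _ k0k).
Qed.

Lemma Gamma_sub_attractor S : Gamma phi S `<=` K.
Proof.
have [C _ [rho _ CP]] := coding_approx.
by move=> _ [w _ <-]; exact: (CP w).1.
Qed.

Lemma Gamma_compacts S : leafless_trees S ->
  nonempty_compacts_in K (Gamma phi S).
Proof.
move=> Sl; split; last exact: Gamma_sub_attractor.
  by have [w Sw _] := leafless_branch Sl Sl.1.1; exists (coding phi w); exists w.
have [_ Kcomp _] := hK.
exact: subclosed_compact (@Gamma_closed S) Kcomp (@Gamma_sub_attractor S).
Qed.

(** Membership of [Gamma phi S] in an open ball is decided by finitely many levels of [S]. This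
    makes Hausdorff balls measurable events. *)
Lemma hausdorff_Gamma_lt A (e : R) S : nonempty_compacts_in K A ->
  leafless_trees S -> hausdorff_dist A (Gamma phi S) < e ->
  exists n, forall T, leafless_trees T -> level S n = level T n ->
    hausdorff_dist A (Gamma phi T) < e.
Proof.
move=> [A0 Acomp _] Sl; have [S0 Scomp _] := Gamma_compacts Sl.
move=> /(hausdorff_dist_lt A0 S0 Acomp Scomp)[e' [e'0 e'e AS SA]].
pose del := (e - e') / 2.
have del0 : 0 < del by rewrite divr_gt0 ?subr_gt0.
have [n nP] := Gamma_level del0.
exists n => T Tl ST; apply: (@le_lt_trans _ _ (e' + del)); last first.
  by rewrite -ltrBrDl [ltRHS]splitr ltrDl.
apply: hausdorff_dist_le => [|a Aa|c Tc]; first by rewrite addr_ge0// ltW.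
- have [b Sb ab] := AS _ Aa; have [c Tc bc] := nP _ _ Sl Tl ST _ Sb.
  exists c => //; apply: le_trans (edistance_triangle b _ _) _.
  by rewrite lerD// ltW.
- have [b Sb bc] := nP _ _ Tl Sl (esym ST) _ Tc; have [a Aa ab] := SA _ Sb.
  exists a => //; apply: le_trans (edistance_triangle b _ _) _.
  by rewrite lerD// edistanceC ltW.
Qed.

Lemma hausdorff_Gamma_level (e : R) : 0 < e -> exists n, forall S T,
  leafless_trees S -> leafless_trees T -> level S n = level T n ->
  hausdorff_dist (Gamma phi S) (Gamma phi T) < e.
Proof.
move=> e0; have e20 : 0 < e / 2 by rewrite divr_gt0.
have [n nP] := Gamma_level e20.
exists n => S T Sl Tl ST; apply: (@le_lt_trans _ _ (e / 2)); last by rewrite [ltRHS]splitr ltrDl.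
apply: hausdorff_dist_le => [|a Sa|b Tb]; first exact: ltW.
- by have [b Tb /ltW ab] := nP _ _ Sl Tl ST _ Sa; exists b.
- by have [a Sa /ltW ab] := nP _ _ Tl Sl (esym ST) _ Tb; exists a => //; rewrite edistanceC.
Qed.

(* The limit [S] is an ultralimit of trees approximating [A]; it agrees with
   some of them on every finite set of words, so it inherits any property that
   is decided locally. *)
Lemma Gamma_limit (C : set (set (seq Lambda))) A : C `<=` leafless_trees ->
  (forall S, (forall n, exists2 T, C T & forall v, (size v <= n)%N -> S v <-> T v) -> C S) ->
  nonempty_compacts_in K A ->
  (forall e : R, 0 < e -> exists2 S, C S & hausdorff_dist A (Gamma phi S) < e) ->
  (Gamma phi @` C) A.
Proof.
move=> Cl Cclosed Kc Aapp; have [A0 Acomp _] := Kc.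
have /choice[x xP] k : exists S, C S /\ hausdorff_dist A (Gamma phi S) < k.+1%:R^-1.
  have k0 : 0 < k.+1%:R^-1 :> R by rewrite invr_gt0.
  by have [S CS ?] := Aapp _ k0; exists S.
have [y yP] := ultralimit (fun k v => `[< x k v >]).
pose S : set (seq Lambda) := [set v | y v].
have Sx n k0 : exists2 k, (k0 <= k)%N & forall v, (size v <= n)%N -> S v <-> x k v.
  have [s sP] := (finite_seqP _).1 (finite_size_le (Lambda := Lambda) n).
  have [k k0k kP] := yP s k0; exists k => // v vn.
  have vs : v \in s by have : [set` s] v by rewrite -sP.
  by rewrite /S /= -(kP _ vs); split=> /asboolP.
have CS : C S.
  by apply: Cclosed => n; have [k _ kP] := Sx n 0%N; exists (x k); [exact: (xP k).1|].
exists S => //.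
have Sl := Cl _ CS; have [_ Scomp _] := Gamma_compacts Sl.
have near (e : R) : 0 < e -> exists2 T, C T & hausdorff_dist A (Gamma phi T) < e /\
    (forall a, Gamma phi S a -> exists2 b, Gamma phi T b & edistance a b < e) /\
    (forall a, Gamma phi T a -> exists2 b, Gamma phi S b & edistance a b < e).
  move=> e0; have [n nP] := Gamma_level e0.
  have [k0 _ k0P] := near_infty_natSinv_lt (PosNum e0).
  have [k k0k kP] := Sx n k0.
  have ST : level S n = level (x k) n.
    by apply/seteqP; split=> v [Sv vn]; split=> //; apply/kP; rewrite ?vn.
  have Tl := Cl _ (xP k).1.
  exists (x k); first exact: (xP k).1.
  split; first exact: lt_trans (xP k).2 (k0P _ k0k).
  by split; apply: nP.
have halves (e : R) : 0 < e -> 0 < e / 2 by move=> ?; rewrite divr_gt0.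
have Acl := compact_closed (@norm_hausdorff _ _) Acomp.
(* A point of one set is moved first to a tree [T] near both, then to the other set, each time by
   less than half of [e]; both sets are closed. *)
apply/seteqP; split=> a.
- move=> Sa; apply: closed_approx => // e /halves e20.
  have [T CT [AT [ST _]]] := near _ e20.
  have [T0 Tcomp _] := Gamma_compacts (Cl _ CT).
  have [e' [_ e'e _ TA]] := hausdorff_dist_lt A0 T0 Acomp Tcomp AT.
  have [b Tb ab] := ST _ Sa; have [c Ac cb] := TA _ Tb.
  exists c => //; apply: le_lt_trans (edistance_triangle b _ _) _.
  by rewrite [ltRHS]splitr ltrD// edistanceC; exact: le_lt_trans cb _.
- move=> Aa; apply: (closed_approx (@Gamma_closed S)) => // e /halves e20.
  have [T CT [AT [_ TS]]] := near _ e20.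
  have [T0 Tcomp _] := Gamma_compacts (Cl _ CT).
  have [e' [_ e'e TA _]] := hausdorff_dist_lt A0 T0 Acomp Tcomp AT.
  have [b Tb ab] := TA _ Aa; have [c Sc bc] := TS _ Tb.
  exists c => //; apply: le_lt_trans (edistance_triangle b _ _) _.
  by rewrite [ltRHS]splitr ltrD//; exact: le_lt_trans ab _.
Qed.

End Coding.

(** * The space of offspring assignments *)

HB.instance Definition _ (T : finType) := isPointed.Build {set T} (finset.set0 : {set T}).

Section Environments.
Context {Lambda : finType}.
Implicit Types (S : set (seq Lambda)) (u v : seq Lambda) (j : Lambda).

(** Events constraining finitely many coordinates; they form a pi-system generating the product
    sigma-algebra [env]. *)
Definition cylinder (s : seq (seq Lambda)) (B : seq Lambda -> set {set Lambda}) :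
  set (seq Lambda -> {set Lambda}) := [set e | forall i, i \in s -> B i (e i)].

Definition cylinders : set (set (seq Lambda -> {set Lambda})) :=
  [set E | exists s B, uniq s /\ E = cylinder s B].

Definition env := g_sigma_algebraType cylinders.
Implicit Types (e : env) (E : set env).

Lemma setI_closed_cylinders : setI_closed cylinders.
Proof.
move=> _ _ [s [B [us ->]]] [t [C [ut ->]]].
(* Each constraint is guarded by membership in its own list, since [B] must not bind indices that
   occur only in [t], nor [C] those only in [s]. *)
exists (undup (s ++ t)), (fun i => [set b | (i \in s -> B i b) /\ (i \in t -> C i b)]).
split; first exact: undup_uniq.
apply/seteqP; split=> e /= => [[eB eC] i _|eBC].
  by split=> ?; [exact: eB|exact: eC].
split=> i ii; first by have [|+ _] := eBC i; [rewrite mem_undup mem_cat ii|apply].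
by have [|_ +] := eBC i; [rewrite mem_undup mem_cat ii orbT|apply].
Qed.

Lemma measurable_cylinder s B : uniq s -> measurable (cylinder s B : set env).
Proof. by move=> us; apply: sub_gen_smallest; exists s, B. Qed.

Lemma measurable_coordinate v (B : set {set Lambda}) :
  measurable ([set e | B (e v)] : set env).
Proof.
have -> : [set e | B (e v)] = cylinder [:: v] (fun=> B).
  apply/seteqP; split=> e /= => [eB i|]; first by rewrite inE => /eqP ->.
  by apply; rewrite mem_head.
exact: measurable_cylinder.
Qed.

Lemma measurable_shift v : measurable_fun [set: env] (env_shift v : env -> env).
Proof.
apply: (@measurability _ _ env env setT (env_shift v) cylinders) => // _ [_ [s [B [us ->]]] <-].
rewrite setTI.
have -> : (env_shift v : env -> env) @^-1` cylinder s B =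
    cylinder [seq v ++ i | i <- s] (fun i => B (drop (size v) i)).
  apply/seteqP; split=> e /= => eB i.
    by move=> /mapP[k ks ->]; rewrite drop_size_cat//; exact: eB.
  by move=> /(map_f (cat v))/eB; rewrite drop_size_cat.
apply: measurable_cylinder; rewrite map_inj_uniq// => a b.
by move=> /(congr1 (drop (size v))); rewrite !drop_size_cat.
Qed.

Lemma measurable_shift_preimage v E : measurable E ->
  measurable ([set e | E (env_shift v e)] : set env).
Proof. by move=> mE; rewrite -[X in measurable X]setTI; exact: measurable_shift. Qed.

Lemma measurable_GW_tree v : measurable ([set e : env | GW_tree e v] : set env).
Proof.
elim/last_ind: v => [|v j IH].
  have -> : [set e : env | GW_tree e [::]] = [set: env]; last exact: measurableT.
  by apply/seteqP; split=> // e _; exact: GW_tree_nil.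
have -> : [set e : env | GW_tree e (rcons v j)] =
    [set e : env | GW_tree e v] `&` [set e : env | j \in e v].
  by apply/seteqP; split=> e; rewrite /= GW_tree_rcons.
apply: measurableI => //; exact: (@measurable_coordinate v [set A | j \in A]).
Qed.

Lemma measurable_forall (T : countType) (F : T -> set env) :
  (forall t, measurable (F t)) -> measurable [set e | forall t, F t e].
Proof.
move=> mF; have -> : [set e | forall t, F t e] = ~` (\bigcup_t ~` F t).
  by rewrite setC_bigcup; apply/seteqP; split=> e /= eF t;
    [rewrite setCK => _; exact: eF|have := eF t I; rewrite setCK].
apply: measurableC; apply: countable_bigcupT_measurable => [|t].
  exact: countableP.
exact: measurableC.
Qed.

Lemma measurable_exists (T : countType) (F : T -> set env) :
  (forall t, measurable (F t)) -> measurable [set e | exists t, F t e].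
Proof.
move=> mF; have -> : [set e | exists t, F t e] = \bigcup_t F t.
  by apply/seteqP; split=> e /= => [[t ?]|[t _ ?]]; exists t.
by apply: countable_bigcupT_measurable => //; exact: countableP.
Qed.

Lemma measurable_imply (Q : Prop) E : (Q -> measurable E) ->
  measurable [set e | Q -> E e].
Proof.
move=> mE; have [q|nq] := pselect Q.
  have -> : [set e | Q -> E e] = E by apply/seteqP; split=> e /= => [/(_ q)|].
  exact: mE.
have -> : [set e | Q -> E e] = setT by apply/seteqP; split=> // e _ /nq.
exact: measurableT.
Qed.

Lemma measurable_iff (Q : Prop) E : measurable E -> measurable [set e | E e <-> Q].
Proof.
move=> mE; have [q|nq] := pselect Q.
  have -> : [set e | E e <-> Q] = E by apply/seteqP; split=> e /=; tauto.
  by [].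
have -> : [set e | E e <-> Q] = ~` E by apply/seteqP; split=> e /=; tauto.
exact: measurableC.
Qed.

Definition survives : set env := [set e | infinite_set (GW_tree e)].

Lemma measurable_survives : measurable survives.
Proof.
have -> : survives =
    [set e : env | forall n, exists v, GW_tree e v /\ size v = n].
  apply/seteqP; split=> e /= => [/(infinite_treeP (GW_tree_is_tree e)) eoo n|eall].
    by have [v ? ?] := eoo n; exists v.
  apply/(infinite_treeP (GW_tree_is_tree e)) => n.
  by have [v [? ?]] := eall n; exists v.
apply: (@measurable_forall nat (fun n => [set e : env | exists v, GW_tree e v /\ size v = n])) => n.
apply: (@measurable_exists _ (fun v => [set e : env | GW_tree e v /\ size v = n])) => v.
have [vn|vn] := pselect (size v = n).
  have -> : [set e : env | GW_tree e v /\ size v = n] = [set e : env | GW_tree e v].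
    by apply/seteqP; split=> e /=; tauto.
  exact: measurable_GW_tree.
have -> : [set e : env | GW_tree e v /\ size v = n] = set0.
  by apply/seteqP; split=> e /=; tauto.
exact: measurable0.
Qed.

Lemma reduced_GW_tree e v :
  reduced (GW_tree e) v <-> GW_tree e v /\ survives (env_shift v e).
Proof.
by split=> -[ev evoo]; split=> //; move: evoo; rewrite subtree_GW_tree.
Qed.

Lemma survives_shift e v : GW_tree e v -> survives (env_shift v e) -> survives e.
Proof.
move=> ev svoo sfin; apply: svoo.
apply: (@sub_finite_set _ _ (drop (size v) @` GW_tree e)); last exact: finite_image.
by move=> u eu; exists (v ++ u); rewrite ?drop_size_cat// GW_tree_cat.
Qed.

Lemma survives_child e : survives e ->
  exists2 j, j \in e [::] & survives (env_shift [:: j] e).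
Proof.
move=> /(infinite_child (GW_tree_is_tree e))[j ej oo]; exists j.
  exact/GW_tree1.
by rewrite /survives /= -subtree_GW_tree.
Qed.

(** Survival is built in, so every pattern is an event to which the recurrence argument applies. *)
Definition pattern n (L : set (seq Lambda)) : set env :=
  [set e | survives e /\ level (reduced (GW_tree e)) n = L].

Lemma measurable_pattern n L : measurable (pattern n L).
Proof.
have -> : pattern n L = survives `&`
    [set e : env | forall v, level (reduced (GW_tree e)) n v <-> L v].
  apply/seteqP; split=> e [esurv eL]; split=> //; first by rewrite /= eL.
  by apply/seteqP; split=> v /eL.
apply: measurableI; first exact: measurable_survives.
apply: (@measurable_forall _ (fun v => [set e : env | level (reduced (GW_tree e)) n v <-> L v])) => v.
apply: (@measurable_iff (L v) [set e : env | level (reduced (GW_tree e)) n v]).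
have [vn|vn] := eqVneq (size v) n; last first.
  have -> : [set e : env | level (reduced (GW_tree e)) n v] = set0.
    by apply/seteqP; split=> // e [_ /eqP]; rewrite (negbTE vn).
  exact: measurable0.
have -> : [set e : env | level (reduced (GW_tree e)) n v] =
    [set e : env | GW_tree e v] `&` [set e | survives (env_shift v e)].
  by apply/seteqP; split=> e; rewrite /level /= reduced_GW_tree; [case|split].
apply: measurableI; first exact: measurable_GW_tree.
exact: (measurable_shift_preimage v measurable_survives).
Qed.

(** The complement of recurrence: no node of the tree sees [E] in the subtree below it. *)
Definition avoiding E : set env :=
  [set e : env | forall v, GW_tree e v -> ~ E (env_shift v e)].

Lemma measurable_avoiding E : measurable E -> measurable (avoiding E).
Proof.
move=> mE; apply: (@measurable_forall _ (fun v => [set e : env | GW_tree e v -> ~ E (env_shift v e)])).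
move=> v; have -> : [set e : env | GW_tree e v -> ~ E (env_shift v e)] =
    ~` [set e : env | GW_tree e v] `|` ~` [set e | E (env_shift v e)].
  by apply/seteqP; split=> e /=; [have [|] := pselect (GW_tree e v)|]; tauto.
apply: measurableU; apply: measurableC; first exact: measurable_GW_tree.
exact: (measurable_shift_preimage v mE).
Qed.

Lemma avoiding_child E e j : avoiding E e -> j \in e [::] ->
  avoiding E (env_shift [:: j] e).
Proof.
move=> eE je v ev; rewrite -env_shift_cat; apply: eE.
by rewrite cat1s GW_tree_cons.
Qed.

End Environments.

(** * Independence and the branching property *)

Section DynkinIndependence.
Context {R : realType} {dO : measure_display} {Omega : measurableType dO}.
Variable P : probability Omega R.
Local Open Scope ereal_scope.

(** Both sides are finite measures in [C] of total mass [P H], so the sets on which they agree form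
    a Dynkin system. The equation says that given [H], [Y] has the law of [Z]. *)
Lemma dynkin_independent {dE : measure_display} {E : measurableType dE}
    (G : set (set E)) (Y Z : Omega -> E) (H : set Omega) :
  @measurable _ E = <<s G >> -> setI_closed G ->
  measurable_fun setT Y -> measurable_fun setT Z -> measurable H ->
  (forall C, G C -> P (H `&` Y @^-1` C) = P H * P (Z @^-1` C)) ->
  forall C, measurable C -> P (H `&` Y @^-1` C) = P H * P (Z @^-1` C).
Proof.
move=> mE GI mY mZ mH indep.
have mYC C : measurable C -> measurable (Y @^-1` C).
  by move=> mC; rewrite -[X in measurable X]setTI; exact: mY.
have mZC C : measurable C -> measurable (Z @^-1` C).
  by move=> mC; rewrite -[X in measurable X]setTI; exact: mZ.
pose Q := [set C : set E | measurable C /\ P (H `&` Y @^-1` C) = P H * P (Z @^-1` C)].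
suff : <<d G >> `<=` Q.
  by rewrite setI_closed_g_dynkin_g_sigma_algebra// -mE => GQ C /GQ[].
apply: smallest_sub; last first.
  by move=> C GC; split; [rewrite mE; exact: sub_gen_smallest|exact: indep].
have PHfin : P H \is a fin_num by exact: fin_num_measure.
split.
- by split; [exact: measurableT|rewrite !preimage_setT setIT probability_setT mule1].
- move=> C [mC PC]; split; first exact: measurableC.
  rewrite -!preimage_setC -setDE measureD//; last 2 first.
    exact: mYC.
    by rewrite ltey_eq PHfin.
  rewrite [X in _ - X]PC probability_setC; last exact: mZC.
  by rewrite muleBr// ?mule1// fin_num_adde_defr.
- move=> F tF FQ; have mF n : measurable (F n) by case: (FQ n).
  split; first exact: bigcupT_measurable.
  rewrite !preimage_bigcup setI_bigcupr !measure_bigcup//=.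
  + rewrite -(fineK PHfin) -nneseriesZl//; apply: eq_eseriesr => n _.
    by rewrite (FQ n).2 fineK.
  + by move=> n _; exact: mZC.
  + by move=> i j _ _ [w []]; move: (tF i j I I) => + ? ?; apply; exists (Z w).
  + by move=> n _; apply: measurableI => //; exact: mYC.
  + by move=> i j _ _ [w [[_ ?] [_ ?]]]; apply: (tF i j I I); exists (Y w).
Qed.

End DynkinIndependence.

(** * The branching property at the root, and offspring sets of positive probability *)

Section Branching.
Context {R : realType} {dO : measure_display} {Omega : measurableType dO}.
Variable P : probability Omega R.
Context {Lambda : finType}.
Variables (W : Omega -> {set Lambda}) (Wa : seq Lambda -> Omega -> {set Lambda}).
Hypothesis hWa : independent_copies P W Wa.
Implicit Types (S : set (seq Lambda)) (v : seq Lambda) (j : Lambda) (A : {set Lambda}).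

Definition environment (w : Omega) : @env Lambda := fun a => Wa a w.
Local Notation X := environment.
Local Open Scope ereal_scope.

Lemma measurable_environment : measurable_fun setT X.
Proof.
apply: (@measurability _ _ Omega env setT X cylinders) => // _ [_ [s [B [us ->]]] <-].
rewrite setTI.
have -> : X @^-1` cylinder s B = \bigcap_(i in [set` s]) (Wa i @^-1` B i).
  by apply/seteqP; split=> w.
apply: fin_bigcap_measurable; first exact: finite_seq.
by move=> i _; have [+ _ _] := hWa; apply.
Qed.

Lemma measurable_event E : measurable E -> measurable (X @^-1` E).
Proof. by move=> mE; rewrite -[X in measurable X]setTI; exact: measurable_environment. Qed.

Lemma cylinder_prob s B : uniq s ->
  P (X @^-1` cylinder s B) = \prod_(i <- s) P (W @^-1` B i).
Proof.
move=> us; have [_ same indep] := hWa.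
rewrite -(eq_bigr _ (fun i _ => same i (B i))) -indep//.
Qed.

(** No word of [s] starts with a letter of [js]: the coordinates in [s] are disjoint from those
    driving the subtrees at [js]. *)
Definition outside (js : seq Lambda) (s : seq (seq Lambda)) :=
  forall i j v, i \in s -> j \in js -> i <> j :: v.

Definition children_in (E : Lambda -> set (@env Lambda)) (js : seq Lambda) : set Omega :=
  [set w | forall j, j \in js -> E j (env_shift [:: j] (X w))].

Lemma measurable_children_in E js : (forall j, measurable (E j)) ->
  measurable (children_in E js).
Proof.
move=> mE; have -> : children_in E js =
    X @^-1` [set e | forall j, (j \in js) -> E j (env_shift [:: j] e)] by [].
apply: measurable_event.
apply: (@measurable_forall _ _ (fun j => [set e : env | j \in js -> E j (env_shift [:: j] e)])) => j.
apply: (@measurable_imply _ _ [set e : env | E j (env_shift [:: j] e)]) => _.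
exact: measurable_shift_preimage.
Qed.

(** Induction on [js]. The Dynkin argument reduces the event at the new child to a cylinder, which
    is absorbed into the one on [s]; this is why [s] and [B] are arbitrary in the statement. *)
Lemma branching_prob (js : seq Lambda) (E : Lambda -> set (@env Lambda)) :
  uniq js -> (forall j, measurable (E j)) ->
  forall s B, uniq s -> outside js s ->
  P (X @^-1` cylinder s B `&` children_in E js) =
    P (X @^-1` cylinder s B) * \prod_(j <- js) P (X @^-1` E j).
Proof.
move=> + mE; elim: js => [|j js IH] /=.
  by move=> _ s B us _; rewrite big_nil mule1; congr (P _); apply/seteqP; split=> w //= [].
move=> /andP[jjs ujs] s B us out.
have outjs : outside js s by move=> i k v is_ kjs; apply: out; rewrite // inE kjs orbT.
pose H := X @^-1` cylinder s B `&` children_in E js.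
have mH : measurable H.
  apply: measurableI; last exact: measurable_children_in.
  by apply: measurable_event; exact: measurable_cylinder.
pose Y w := env_shift [:: j] (X w) : env.
have mY : measurable_fun setT Y.
  exact: measurableT_comp (measurable_shift [:: j]) measurable_environment.
have -> : X @^-1` cylinder s B `&` children_in E (j :: js) = H `&` Y @^-1` E j.
  apply/seteqP; split=> w.
    move=> [sB EE]; split; last by apply: EE; rewrite mem_head.
    by split=> // k kjs; apply: EE; rewrite inE kjs orbT.
  by move=> [[sB EE] Ej]; split=> // k; rewrite inE => /orP[/eqP -> //|]; exact: EE.
rewrite (@dynkin_independent _ _ _ P _ (@env Lambda) cylinders Y X H)//; last 3 first.
- exact: setI_closed_cylinders.
- exact: measurable_environment.
- move=> _ [t [D [ut ->]]].
  (* The cylinder on [t] seen from child [j] constrains the words [j :: i]. By [outside] none of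
     them is in [s], so [B'] can read [D] there after dropping the first letter. *)
  pose s' := s ++ [seq j :: i | i <- t].
  pose B' i := if i \in s then B i else D (behead i).
  have jt i : (j :: i \in s) = false.
    by apply/negP => is_; apply: (out _ j i is_ (mem_head _ _)).
  have us' : uniq s'.
    rewrite cat_uniq us map_inj_uniq ?ut ?andbT/=; last by move=> ? ? [].
    by apply/hasPn => _ /mapP[i _ ->]; rewrite /= jt.
  have outs' : outside js s'.
    move=> i k v; rewrite mem_cat => /orP[|/mapP[a _ ->]]; first exact: outjs.
    by move=> kjs [jk _]; rewrite jk kjs in jjs.
  have -> : H `&` Y @^-1` cylinder t D = X @^-1` cylinder s' B' `&` children_in E js.
    apply/seteqP; split=> w.
      move=> [[sB EE] tD]; split=> // i; rewrite mem_cat /B'.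
      by case: ifPn => [is_ _|_ /= /mapP[a at_ ->]]; [exact: sB|exact: tD].
    move=> [sB' EE]; split; first split=> //.
      by move=> i is_; have := sB' i; rewrite mem_cat is_ /B' is_; exact.
    move=> i it; have := sB' (j :: i); rewrite mem_cat (map_f _ it) orbT /B' jt.
    exact.
  rewrite IH// /H IH// !cylinder_prob// big_cat/= big_map -muleA [RHS]muleAC -muleA; congr (_ * _).
    by apply: eq_big_seq => i is_; rewrite /B' is_.
  by congr (_ * _); apply: eq_bigr => i _; rewrite /B' jt.
by rewrite /H IH// big_cons -muleA [_ * P _]muleC.
Qed.

(* The subtrees hanging off the children of the root are independent copies of
   the whole tree. *)
Lemma root_branching A (E : Lambda -> set (@env Lambda)) :
  (forall j, measurable (E j)) ->
  P [set w | Wa [::] w = A /\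
      forall j, j \in A -> E j (env_shift [:: j] (X w))] =
    P (W @^-1` [set A]) * \prod_(j in A) P (X @^-1` E j).
Proof.
move=> mE.
have := @branching_prob (enum A) E (enum_uniq A) mE [:: [::]] (fun=> [set A]) isT.
rewrite cylinder_prob// big_seq1 big_enum => <-.
  congr (P _); apply/seteqP; split=> w.
    move=> [WA WE]; split=> [i|j]; first by rewrite inE => /eqP ->.
    by rewrite mem_enum; exact: WE.
  move=> [WA WE]; split=> [|j jA]; first exact: (WA [::] (mem_head _ _)).
  by apply: WE; rewrite mem_enum.
by move=> i j v; rewrite inE => /eqP ->.
Qed.

Definition charged A := 0 < P (W @^-1` [set A]).

(** The induction step for positivity: a charged offspring set at the root and an event of positive
    probability below each child occur together, as independence multiplies their probabilities. *)
Lemma root_branching_gt0 A (E : Lambda -> set (@env Lambda)) (F : set (@env Lambda)) :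
  (forall j, measurable (E j)) -> measurable F -> charged A ->
  (forall j, j \in A -> 0 < P (X @^-1` E j)) ->
  (forall e, e [::] = A -> (forall j, j \in A -> E j (env_shift [:: j] e)) -> F e) ->
  0 < P (X @^-1` F).
Proof.
move=> mE mF Ach EA EF.
apply: (@lt_le_trans _ _ (P [set w | Wa [::] w = A /\
      forall j, j \in A -> E j (env_shift [:: j] (X w))])).
  rewrite root_branching// mule_gt0//.
  by elim/big_ind: _ => // x y; exact: mule_gt0.
apply: le_measure; rewrite ?inE.
- have -> : [set w | Wa [::] w = A /\ forall j, j \in A -> E j (env_shift [:: j] (X w))] =
      X @^-1` [set e : env | e [::] = A] `&` children_in E (enum A).
    apply/seteqP; split=> w [wA wE]; split=> // j.
      by rewrite mem_enum; exact: wE.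
    by move=> jA; apply: wE; rewrite mem_enum.
  apply: measurableI; last exact: measurable_children_in.
  apply: measurable_event; exact: (@measurable_coordinate _ [::] [set A]).
- exact: measurable_event.
- by move=> w [wA wE]; apply: EF.
Qed.

Lemma total_probability (U : set Omega) : measurable U ->
  P U = \sum_A P (U `&` [set w | Wa [::] w = A]).
Proof.
move=> mU.
have mW (B : set {set Lambda}) : measurable (U `&` Wa [::] @^-1` B).
  by apply: measurableI => //; have [+ _ _] := hWa; apply.
suff sumP s : uniq s -> P (U `&` [set w | Wa [::] w \in s]) =
    \sum_(A <- s) P (U `&` [set w | Wa [::] w = A]).
  rewrite -sumP ?index_enum_uniq//; congr (P _); apply/seteqP.
  by split=> w => [Uw|[]//]; split=> //=; rewrite mem_index_enum.
elim: s => [_|A s IH /= /andP[As us]].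
  by rewrite big_nil -[RHS](measure0 P); congr (P _); apply/seteqP; split=> w // [].
rewrite big_cons -IH// -measureU.
- congr (P _); apply/seteqP; split=> w /=.
    by rewrite inE => -[Uw /orP[/eqP|]]; [left|right].
  by case=> -[Uw wA]; split=> //; rewrite inE ?wA ?eqxx ?orbT.
- exact: (mW [set A]).
- exact: (mW [set B | B \in s]).
- by apply/seteqP; split=> w //= [[_ ->] [_]]; rewrite (negbTE As).
Qed.

(** There are only countably many values, each uncharged one being null. A general [V] covers both
    [W] itself and every [Wa v]. *)
Lemma negligible_uncharged_value (V : Omega -> {set Lambda}) :
  discrete_rv V -> (forall B, P (V @^-1` B) = P (W @^-1` B)) ->
  P.-negligible [set w | ~ charged (V w)].
Proof.
move=> mV same.
pose F n := if @unpickle {set Lambda} n is Some A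
  then [set w | V w = A /\ ~ charged A] else set0.
apply: (@negligibleS _ _ _ P (\bigcup_n F n)).
  by move=> w vch; exists (pickle (V w)) => //; rewrite /F pickleK.
apply: negligible_bigcup => n; rewrite /F; case: unpickle => [A|]; last exact: negligible_set0.
have [Ach|Ach] := pselect (charged A).
  by apply: negligibleS (negligible_set0 _) => w [_ /(_ Ach)].
exists (V @^-1` [set A]); split; [exact: mV| |by move=> w []].
apply: (etrans (same [set A])); apply/eqP; rewrite eq_le measure_ge0 andbT leNgt.
exact/negP.
Qed.

Lemma negligible_uncharged : P.-negligible [set w | exists v, ~ charged (Wa v w)].
Proof.
have [mWa same _] := hWa.
pose F n := if @unpickle (seq Lambda) n is Some v
  then [set w | ~ charged (Wa v w)] else set0.
apply: (@negligibleS _ _ _ P (\bigcup_n F n)).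
  by move=> w [v vch]; exists (pickle v) => //; rewrite /F pickleK.
apply: negligible_bigcup => n; rewrite /F; case: unpickle => [v|]; last exact: negligible_set0.
exact: negligible_uncharged_value.
Qed.

(** An event of positive probability is not covered by the null set of samples with an uncharged
    offspring set; this turns positivity into a concrete tree. *)
Lemma charged_sample (U : set Omega) : measurable U -> 0 < P U ->
  exists2 w, U w & forall v, charged (Wa v w).
Proof.
move=> mU U0; apply: contrapT => none.
have : P.-negligible U.
  apply: negligibleS negligible_uncharged => w Uw /=.
  by apply: contrapT => wch; apply: none; exists w => // v; apply: contrapT => ?; apply: wch; exists v.
by move=> /(negligibleP _ mU) U00; move: U0; rewrite lt0e; move=> /andP[/eqP]; case.
Qed.

End Branching.

(** * Recurrence of patterns *)

Section FixedPoint.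
Context {R : realType}.

Lemma power_chord_step (q g : R) k :
  g * ((1 - g) * q ^+ k + (g - q)) =
  (1 - g) * q ^+ k.+1 + ((1 - g) * ((g - q) * q ^+ k) + g * (g - q)).
Proof.
by rewrite exprS [RHS]addrA -[in RHS]mulrDr -mulrDl (addrC q) subrK mulrDr mulrCA.
Qed.

(* Convexity of [x ^+ k] between [q] and [1], evaluated at [g]. *)
Lemma power_chord (q g : R) k : 0 <= q -> q <= g -> g <= 1 ->
  (1 - q) * g ^+ k <= (1 - g) * q ^+ k + (g - q).
Proof.
move=> q0 qg g1; have g0 := le_trans q0 qg.
elim: k => [|k IH]; first by rewrite !expr0 !mulr1 addrA subrK.
rewrite exprS mulrCA; apply: le_trans (ler_wpM2l g0 IH) _.
rewrite power_chord_step lerD2l [leRHS](_ : _ = (1 - g) * (g - q) + g * (g - q)); last first.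
  by rewrite -mulrDl subrK mul1r.
rewrite lerD2r ler_wpM2l ?subr_ge0// ler_piMr ?subr_ge0//.
by rewrite exprn_ile1// (le_trans qg).
Qed.

(** One more induction step is strict because [q ^+ k.+1 < 1]. The exponent is at least 2, since
    lower powers are affine. *)
Lemma power_chord_lt (q g : R) k : 0 <= q -> q < g -> g < 1 ->
  (1 - q) * g ^+ k.+2 < (1 - g) * q ^+ k.+2 + (g - q).
Proof.
move=> q0 qg g1; have g0 := le_trans q0 (ltW qg).
rewrite exprS mulrCA.
apply: le_lt_trans (ler_wpM2l g0 (power_chord k.+1 q0 (ltW qg) (ltW g1))) _.
rewrite power_chord_step ltrD2l [ltRHS](_ : _ = (1 - g) * (g - q) + g * (g - q)); last first.
  by rewrite -mulrDl subrK mul1r.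
rewrite ltrD2r ltr_pM2l ?subr_gt0// gtr_pMr ?subr_gt0//.
by rewrite exprn_ilt1// (lt_trans qg).
Qed.

(** Write [f] for the generating function. If [q < g], averaging the chord inequalities, strict at
    [i0], gives [(1 - q) * f g < (1 - g) * f q + (g - q)]. With [f q <= q] the right side is at most
    [(1 - q) * g], against [g <= f g]. *)
Lemma offspring_fixpoint (I : finType) (p : I -> R) (m : I -> nat) (q g : R) i0 :
  (forall i, 0 <= p i) -> \sum_i p i = 1 -> (1 < m i0)%N -> 0 < p i0 ->
  0 <= q -> q <= g -> g < 1 ->
  \sum_i p i * q ^+ m i <= q -> g <= \sum_i p i * g ^+ m i -> g = q.
Proof.
move=> p0 p1 mi0 pi0 q0 + g1 fq fg; rewrite le_eqVlt => /orP[/eqP //|qg].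
suff : (1 - q) * g < (1 - q) * g by rewrite ltxx.
have q1 : 0 <= 1 - q by rewrite subr_ge0 ltW// (lt_trans qg).
apply: le_lt_trans (ler_wpM2l q1 fg) _.
apply: (@lt_le_trans _ _ ((1 - g) * \sum_i p i * q ^+ m i + (g - q))); last first.
  rewrite -lerBrDr; apply: le_trans (ler_wpM2l _ fq) _; first by rewrite subr_ge0 ltW.
  by rewrite !mulrBl !mul1r opprB [g * q]mulrC [leRHS]addrC addrA subrK.
have -> : g - q = \sum_i p i * (g - q) by rewrite -mulr_suml p1 mul1r.
rewrite !mulr_sumr -big_split /=.
have cmp i : (1 - q) * (p i * g ^+ m i) <= (1 - g) * (p i * q ^+ m i) + p i * (g - q).
  rewrite !(mulrCA _ (p i)) -mulrDr ler_wpM2l//.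
  exact: power_chord q0 (ltW qg) (ltW g1).
rewrite (bigD1 i0)//= [ltRHS](bigD1 i0)//= ltr_leD//; last exact: ler_sum.
rewrite !(mulrCA _ (p i0)) -mulrDr ltr_pM2l//.
by case: (m i0) mi0 => [|[|k]]// _; exact: power_chord_lt.
Qed.

End FixedPoint.

(** * Almost sure recurrence of events that force survival *)

Section Recurrence.
Context {R : realType} {dO : measure_display} {Omega : measurableType dO}.
Variable P : probability Omega R.
Context {Lambda : finType}.
Variables (W : Omega -> {set Lambda}) (Wa : seq Lambda -> Omega -> {set Lambda}).
Hypothesis hWa : independent_copies P W Wa.
Implicit Types (A : {set Lambda}) (C E : set (@env Lambda)).
Local Notation X := (environment Wa).
Local Open Scope ereal_scope.

Let p A : R := fine (P (W @^-1` [set A])).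

Let pE A : P (W @^-1` [set A]) = (p A)%:E.
Proof.
have [mWa same _] := hWa.
have same0 : P (Wa [::] @^-1` [set A]) = P (W @^-1` [set A]) := same _ _.
by rewrite /p -same0 fineK//; apply: fin_num_measure; exact: mWa.
Qed.

Let pr E : R := fine (P (X @^-1` E)).

Let prE E : measurable E -> P (X @^-1` E) = (pr E)%:E.
Proof.
by move=> mE; rewrite /pr fineK//; apply: fin_num_measure; exact: (measurable_event hWa mE).
Qed.

Let root_branching_same A E : measurable E ->
  P [set w | Wa [::] w = A /\ forall j, j \in A -> E (env_shift [:: j] (X w))] =
  (p A * pr E ^+ #|A|)%:E.
Proof.
move=> mE; rewrite (root_branching hWa A (fun=> mE)) pE prE// prodEFin prodr_const.
by rewrite EFinM.
Qed.

Let sum_p : (\sum_A p A = 1)%R.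
Proof.
apply: EFin_inj; rewrite -sumEFin -[RHS](probability_setT P).
rewrite (total_probability hWa measurableT); apply: eq_bigr => A _.
rewrite setTI -pE; have [_ same _] := hWa.
exact/esym/(same [::] [set A]).
Qed.

Let measurable_root A E : measurable E ->
  measurable [set w | Wa [::] w = A /\ forall j, j \in A -> E (env_shift [:: j] (X w))].
Proof.
move=> mE.
have -> : [set w | Wa [::] w = A /\ forall j, j \in A -> E (env_shift [:: j] (X w))] =
    X @^-1` [set e : env | e [::] = A] `&` children_in Wa (fun=> E) (enum A).
  apply/seteqP; split=> w [wA wE]; split=> // j.
    by rewrite mem_enum; exact: wE.
  by move=> jA; apply: wE; rewrite mem_enum.
apply: measurableI; last exact: (measurable_children_in hWa _ (fun=> mE)).
exact: (measurable_event hWa (@measurable_coordinate _ [::] [set A])).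
Qed.

(* With [f] the offspring generating function, the extinction probability [q]
   satisfies [f q <= q] and the probability [g] of avoiding [C] satisfies
   [g <= f g]; strict convexity of [f] leaves only [g = q]. *)
Lemma avoiding_null C A0 : measurable C -> C `<=` survives -> 0 < P (X @^-1` C) ->
  (1 < #|A0|)%N -> charged P W A0 ->
  P (X @^-1` (survives `&` avoiding C)) = 0.
Proof.
move=> mC CN C0 A02 A0ch.
have mG := measurable_avoiding mC.
have mN : measurable (~` @survives Lambda) by apply: measurableC; exact: measurable_survives.
have le_pr E F : measurable E -> measurable F -> E `<=` F -> (pr E <= pr F)%R.
  move=> mE mF EF; rewrite -lee_fin -!prE//; apply: le_measure.
  - by rewrite inE; exact: (measurable_event hWa).
  - by rewrite inE; exact: (measurable_event hWa).
  - by move=> w; exact: EF.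
(* An occurrence of [C] below a node would make the whole tree survive; this gives the inequality
   [q <= g]. *)
have NG : ~` @survives Lambda `<=` avoiding C.
  by move=> e ne v ev /CN/(survives_shift ev).
have gq : pr (avoiding C) = pr (~` @survives Lambda).
  apply: (@offspring_fixpoint R _ p (fun A => #|A|) _ _ A0) => //.
  - by move=> A; rewrite /p fine_ge0.
  - by rewrite -lte_fin -pE.
  - by rewrite fine_ge0.
  - exact: le_pr.
  - have -> : (1 = pr setT)%R.
      by apply: EFin_inj; rewrite -prE// preimage_setT probability_setT.
    rewrite -lte_fin -!prE// preimage_setT probability_setT.
    (* Avoidance at the root already excludes [C], which has positive probability; hence [g < 1]. *)
    apply: (@le_lt_trans _ _ (P (X @^-1` (~` C)))).
      apply: le_measure.
      + by rewrite inE; exact: (measurable_event hWa).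
      + by rewrite inE; apply: (measurable_event hWa); exact: measurableC.
      + by move=> w /= /(_ [::] (GW_tree_nil _)).
    rewrite -preimage_setC probability_setC; last exact: (measurable_event hWa).
    by move: C0; rewrite prE// -EFinB !lte_fin ltrBlDr ltrDl.
  (* If all subtrees at the children of the root die out, so does the tree. *)
  - rewrite -lee_fin -sumEFin -prE// (total_probability hWa (measurable_event hWa mN)).
    apply: lee_sum => A _; rewrite -root_branching_same//.
    apply: le_measure.
    + by rewrite inE; exact: measurable_root.
    + rewrite inE; apply: measurableI; first exact: (measurable_event hWa).
      by have [mWa _ _] := hWa; exact: (mWa [::] [set A]).
    + move=> w [wA wN]; split=> // /survives_child[j jw].
      by apply: wN; rewrite -wA.
  (* Avoidance is inherited by the subtree of every child of the root. *)
  - rewrite -lee_fin -sumEFin -prE// (total_probability hWa (measurable_event hWa mG)).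
    apply: lee_sum => A _; rewrite -root_branching_same//.
    apply: le_measure.
    + rewrite inE; apply: measurableI; first exact: (measurable_event hWa).
      by have [mWa _ _] := hWa; exact: (mWa [::] [set A]).
    + by rewrite inE; exact: measurable_root.
    + move=> w [wG wA]; split=> // j jA; apply: avoiding_child => //.
      by rewrite /environment wA.
have -> : X @^-1` (survives `&` avoiding C) =
    X @^-1` avoiding C `\` X @^-1` (~` @survives Lambda).
  apply/seteqP; split=> w [] => [ws wa|wa ws]; split=> //.
  exact: contrapT.
rewrite measureD; first last.
- by rewrite [X in X < _]prE// ltry.
- exact: (measurable_event hWa).
- exact: (measurable_event hWa).
rewrite setIidr; last by move=> w; exact: NG.
by rewrite [X in X - _]prE// [X in _ - X]prE// gq subee.
Qed.

(** Otherwise [W] has at most one element almost surely, and its expected size is at most 1. The set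
    found here provides strict convexity of the generating function. *)
Lemma supercritical_charged : discrete_rv W ->
  1 < 'E_P[fun w => #|W w|%:R] ->
  exists2 A : {set Lambda}, (1 < #|A|)%N & charged P W A.
Proof.
move=> mW; rewrite ltNge => /negP super; apply: contrapT => none; apply: super.
have meas : measurable_fun [set: Omega] (EFin \o (fun w => #|W w|%:R : R)).
  move=> _ B _; rewrite setTI.
  exact: (mW [set A : {set Lambda} | B (#|A|%:R)%:E]).
rewrite unlock -[leRHS](probability_setT P) -[leRHS]mul1e -integral_cst//.
apply: ae_ge0_le_integral => //.
have [B [mB B0 sB]] : P.-negligible [set w | ~ charged P W (W w)].
  exact: negligible_uncharged_value.
exists B; split=> // w nw; apply: sB => /= Wch; apply: nw => _.
rewrite lee_fin -[1%R]/(1%:R : R) ler_nat leqNgt.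
by apply/negP => W2; apply: none; exists (W w).
Qed.

End Recurrence.

(** * Charged trees *)

Section Supports.
Context {R : realType} {dO : measure_display} {Omega : measurableType dO}.
Variable P : probability Omega R.
Context {Lambda : finType}.
Variables (W : Omega -> {set Lambda}) (Wa : seq Lambda -> Omega -> {set Lambda}).
Hypothesis hWa : independent_copies P W Wa.
Implicit Types (A : {set Lambda}) (S T : set (seq Lambda)) (v : seq Lambda).
Local Notation X := (environment Wa).
Local Notation N := (@survives Lambda).
Local Notation charged := (charged P W).

Definition charged_trees : set (set (seq Lambda)) :=
  [set S | infinite_trees S /\ forall v, S v -> charged (children S v)].

(* A proper subset [children S v] of a charged [A] occurs as the offspring of
   [v] in the reduced tree only if the other children can die out. *)
Definition reduced_charged_trees : set (set (seq Lambda)) :=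
  [set S | leafless_trees S /\ forall v, S v -> exists A,
    [/\ charged A, children S v \subset A &
        children S v = A \/ charged finset.set0]].

(** A child lost in the reduction roots a finite subtree. This has a leaf, whose offspring set is
    empty and charged. *)
Lemma reduced_charged S : charged_trees S -> reduced_charged_trees (reduced S).
Proof.
move=> [[St Soo] Sch]; split; first exact: reduced_leafless.
move=> v [Sv Svoo]; exists (children S v); split; first exact: Sch.
  by apply/fintype.subsetP => j /in_children[? _]; exact/in_children.
have [->|neq] := eqVneq (children (reduced S) v) (children S v); first by left.
right; have [j Sj Srj] : exists2 j, S (rcons v j) & ~ reduced S (rcons v j).
  apply: contrapT => none; move/eqP: neq; apply; apply/setP => j.
  apply/idP/idP => /in_children Sj; apply/in_children; first by case: Sj.
  by apply: contrapT => ?; apply: none; exists j.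
have Sjfin : finite_set (subtree S (rcons v j)).
  by apply: contrapT => ?; apply: Srj.
have [u Su leaf] := finite_tree_leaf (is_tree_subtree St Sj) Sjfin.
have <- : children S (rcons v j ++ u) = finset.set0; last exact: Sch.
by apply/setP => k; rewrite finset.in_set0; apply/negP => /in_children; rewrite rcons_cat; exact: leaf.
Qed.

(* Adjoin to [S] siblings that die at once. *)
Lemma charged_completion S : reduced_charged_trees S ->
  exists2 T, charged_trees T & boundary T = boundary S.
Proof.
move=> [Sl Sch]; have St := Sl.1.
have /choice[e eP] v : exists A,
    (S v -> [/\ charged A, children S v \subset A &
        children S v = A \/ charged finset.set0]) /\ (~ S v -> A = finset.set0).
  have [/[dup] Sv /Sch[A AP]|nSv] := pselect (S v); first by exists A; split.
  by exists finset.set0; split.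
have inS v j : j \in e v -> S v.
  move=> je; apply: contrapT => /(eP v).2 e0; move: je; rewrite e0 finset.in_set0.
  by [].
have ST : S `<=` GW_tree e.
  elim/last_ind => [_|v j IH Svj]; first exact: GW_tree_nil.
  have Sv : S v by move: Svj; rewrite -cats1; exact: is_tree_prefix.
  apply/GW_tree_rcons; split; first exact: IH.
  have [_ /fintype.subsetP sub _] := (eP v).1 Sv; apply: sub; exact/in_children.
exists (GW_tree e).
  split; first split; first exact: GW_tree_is_tree.
    exact: sub_infinite_set ST (leafless_infinite Sl).
  move=> v ev; rewrite children_GW_tree//.
  have [Sv|nSv] := pselect (S v); first by have [] := (eP v).1 Sv.
  rewrite (eP v).2//; case/lastP: v ev nSv => [_ /(_ St.1)//|v j].
  move=> /GW_tree_rcons[_ je] nSvj.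
  have [_ _ [ve|//]] := (eP v).1 (inS _ _ je).
  by case: nSvj; apply/in_children; rewrite ve.
apply/seteqP; split=> w Tw n; last exact/ST/Tw.
(* A word with a child in the completed tree lies in [S], as [e] is empty elsewhere; hence the look
   one level ahead. *)
by have := Tw n.+1; rewrite mkseqS => /GW_tree_rcons[_ /inS].
Qed.

(** Each condition concerns a node and its children only, so it can be checked in an approximation
    one level deeper. This is the closedness that [Gamma_limit] asks for. *)
Lemma reduced_charged_closed S :
  (forall n, exists2 T, reduced_charged_trees T &
    forall v, (size v <= n)%N -> S v <-> T v) -> reduced_charged_trees S.
Proof.
move=> app; split; first split; first split.
- by have [T [Tl _] /(_ [::] isT) ST] := app 0%N; apply/ST/Tl.1.1.
- move=> u v Suv; have [T [Tl _] ST] := app (size (u ++ v)).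
  apply/ST; first by rewrite size_cat leq_addr.
  by apply: (@is_tree_prefix _ _ _ v Tl.1); apply/ST.
- move=> v Sv; have [T [Tl _] ST] := app (size v).+1.
  have [j Tj] := Tl.2 v ((ST _ (leqnSn _)).1 Sv).
  by exists j; apply/ST; rewrite ?size_rcons.
- move=> v Sv; have [T [Tl Tch] ST] := app (size v).+1.
  have -> : children S v = children T v.
    apply/setP => j; apply/idP/idP => /in_children Sj; apply/in_children;
      by apply/ST; rewrite ?size_rcons.
  exact/Tch/(ST _ (leqnSn _)).1.
Qed.

Lemma reduced_charged_subtree S v : reduced_charged_trees S -> S v ->
  reduced_charged_trees (subtree S v).
Proof.
move=> [Sl Sch] Sv; split; first exact: leafless_subtree.
move=> u /Sch[A AP]; exists A.
have -> : children (subtree S v) u = children S (v ++ u); last by [].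
apply/setP => j; apply/idP/idP => /in_children Sj; apply/in_children;
  by move: Sj; rewrite /subtree /= rcons_cat.
Qed.

Lemma charged_GW w : nonextinction Wa w -> (forall v, charged (Wa v w)) ->
  charged_trees (GW Wa w).
Proof.
move=> Nw wch; split; first by split => //; exact: GW_tree_is_tree.
by move=> v ev; rewrite children_GW_tree.
Qed.

Local Open Scope ereal_scope.

Lemma measurable_nonextinction : measurable (nonextinction Wa).
Proof. exact: (measurable_event hWa (measurable_survives (Lambda := Lambda))). Qed.

Hypothesis survival : 0 < P (nonextinction Wa).

Lemma pattern_gt0 S n : reduced_charged_trees S ->
  0 < P (X @^-1` pattern n (level S n)).
Proof.
elim: n S => [|n IH] S [Sl Sch].
  have -> : X @^-1` pattern 0 (level S 0) = nonextinction Wa; last exact: survival.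
  apply/seteqP; split=> w; first by case.
  move=> Nw; split=> //; apply/seteqP; split=> v [Rv /size0nil ->]; split=> //.
    exact: Sl.1.1.
  by apply/reduced_GW_tree; split; [exact: GW_tree_nil|].
have [A [Ach /fintype.subsetP SA Sdie]] := Sch _ Sl.1.1.
pose E j := if j \in children S [::] then pattern n (level (subtree S [:: j]) n)
  else [set e : @env Lambda | e [::] = finset.set0].
have mdie : measurable [set e : @env Lambda | e [::] = finset.set0].
  exact: (@measurable_coordinate _ [::] [set A | A = finset.set0]).
have die0 : charged finset.set0 -> 0 < P (X @^-1` [set e : @env Lambda | e [::] = finset.set0]).
  by move=> c0; have [_ same _] := hWa; have := same [::] [set finset.set0]; rewrite /preimage /= => ->.
apply: (@root_branching_gt0 _ _ _ P _ W Wa hWa A E (pattern n.+1 (level S n.+1))) => //.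
- by move=> j; rewrite /E; case: ifP => _ //; exact: measurable_pattern.
- exact: measurable_pattern.
- move=> j jA; rewrite /E; case: ifPn => [/in_children Sj|jS].
    by apply: IH; exact: reduced_charged_subtree.
  by apply: die0; case: Sdie => // SAe; rewrite SAe jA in jS.
- move=> e eA eE.
  have esurv : N e.
    have [j Sj] := Sl.2 _ Sl.1.1; have jS : j \in children S [::] by exact/in_children.
    have := eE j (SA _ jS); rewrite /E jS => -[Nj _].
    apply: (@survives_shift _ e [:: j]) => //; apply/GW_tree1.
    by rewrite eA; exact: SA.
  split=> //; apply/seteqP; split=> -[|j v]; try by case.
  + move=> [/reduced_GW_tree[/GW_tree_cons[je ev] Nv]] [vn].
    rewrite eA in je; rewrite -cat1s env_shift_cat in Nv.
    have := eE j je; rewrite /E; case: ifPn => [jS [_ pat]|jS die].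
      have : level (reduced (GW_tree (env_shift [:: j] e))) n v.
        by split=> //; apply/reduced_GW_tree.
      by rewrite pat => -[Sv _]; split=> //; rewrite /= vn.
    have ve : v = [::].
      case: v ev {vn Nv} => // k v /GW_tree_cons[].
      by rewrite die finset.in_set0.
    rewrite ve in Nv; have [k] := survives_child Nv.
    have -> : env_shift [::] (env_shift [:: j] e) [::] = finset.set0 by exact: die.
    by rewrite finset.in_set0.
  + move=> [Sv [vn]].
    have jS : j \in children S [::].
      by apply/in_children; apply: (@is_tree_prefix _ _ [:: j] v Sl.1).
    have := eE j (SA _ jS); rewrite /E jS => -[_ pat].
    have : level (subtree S [:: j]) n v by split.
    rewrite -pat => -[/reduced_GW_tree[ev Nv] _]; split; last by rewrite /= vn.
    apply/reduced_GW_tree; rewrite GW_tree_cons eA -cat1s env_shift_cat.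
    by split=> //; split=> //; exact: SA.
Qed.

Definition agreement n S : set (@env Lambda) :=
  [set e | forall v, (size v <= n)%N -> GW_tree e v <-> S v].

Lemma measurable_agreement n S : measurable (agreement n S).
Proof.
apply: (@measurable_forall _ _ (fun v => [set e : env | (size v <= n)%N -> GW_tree e v <-> S v])) => v.
apply: (@measurable_imply _ _ [set e : env | GW_tree e v <-> S v]) => _.
exact: (measurable_iff _ (measurable_GW_tree v)).
Qed.

Lemma agreement_gt0 S n : charged_trees S ->
  0 < P (X @^-1` (N `&` agreement n S)).
Proof.
(* Subtrees of [S] may be finite, so the induction cannot demand that each survives. Only nodes at
   level [m] are asked to; an infinite tree has such a node, and its survival makes the whole tree
   survive. *)
pose F m T := agreement m T `&` [set e | forall v, size v = m -> T v -> N (env_shift v e)].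
have mF m T : measurable (F m T).
  apply: measurableI; first exact: measurable_agreement.
  apply: (@measurable_forall _ _ (fun v => [set e : env | size v = m -> T v -> N (env_shift v e)])) => v.
  apply: (@measurable_imply _ _ [set e : env | T v -> N (env_shift v e)]) => _.
  apply: (@measurable_imply _ _ [set e : env | N (env_shift v e)]) => _.
  exact: (measurable_shift_preimage v (@measurable_survives _)).
suff main m T : is_tree T -> (forall v, T v -> charged (children T v)) ->
    0 < P (X @^-1` F m T).
  move=> [[St Soo] Sch]; apply: lt_le_trans (main n S St Sch) _.
  apply: le_measure; rewrite ?inE.
  - exact: (measurable_event hWa).
  - apply: (measurable_event hWa); apply: measurableI; first exact: measurable_survives.
    exact: measurable_agreement.
  - move=> w [agr NS]; split=> //.
    have [v Sv vn] := (infinite_treeP St).1 Soo n.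
    apply: (@survives_shift _ (X w) v); last exact: NS.
    by apply/agr; rewrite ?vn.
elim: m T => [|m IH] T Tt Tch.
  have -> : X @^-1` F 0%N T = nonextinction Wa; last exact: survival.
  apply/seteqP; split=> w; first by move=> [_ /(_ [::] erefl Tt.1)].
  move=> Nw; split=> [v|v /size0nil -> //].
  by rewrite leqn0 => /eqP/size0nil ->; split=> _; [exact: Tt.1|exact: GW_tree_nil].
apply: (@root_branching_gt0 _ _ _ P _ W Wa hWa (children T [::])
  (fun j => F m (subtree T [:: j])) (F m.+1 T)) => //.
- exact/Tch/Tt.1.
- move=> j /in_children Tj; apply: IH; first exact: is_tree_subtree.
  move=> v Tv; have -> : children (subtree T [:: j]) v = children T (j :: v).
    by apply/setP => k; apply/idP/idP => /in_children ?; exact/in_children.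
  exact: Tch.
- move=> e eT eF.
  have Tj j v : T (j :: v) -> j \in children T [::].
    by move=> Tjv; apply/in_children; apply: (@is_tree_prefix _ _ [:: j] v Tt).
  split=> [[_|j v vm]|[//|j v] [vm] Tv].
  + by split=> _; [exact: Tt.1|exact: GW_tree_nil].
  + rewrite GW_tree_cons eT; split=> [[jT ev]|Tv].
      by have [/(_ v vm) agr _] := eF _ jT; exact/agr.
    have jT := Tj _ _ Tv; split=> //.
    by have [/(_ v vm) agr _] := eF _ jT; exact/agr.
  + by rewrite -cat1s env_shift_cat; have [_] := eF _ (Tj _ _ Tv); apply.
Qed.

End Supports.

(** * Positivity under the conditioned law *)

Section ConditionalLaw.
Context {R : realType} {dO : measure_display} {Omega : measurableType dO}.
Variable P : probability Omega R.
Local Open Scope ereal_scope.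

(** Division by [P N] preserves positivity, even when [P N] is 0: then the numerator is 0 as well,
    and so is the quotient. *)
Lemma cond_law_gt0 (T : Type) (N : set Omega) (Y : Omega -> T) (B : set T) :
  measurable N -> measurable (N `&` Y @^-1` B) ->
  0 < cond_law P N Y B <-> 0 < P (N `&` Y @^-1` B).
Proof.
move=> mN mNB; rewrite /cond_law; split=> [|NB0].
  rewrite !lt0e measure_ge0 andbT => /andP[+ _].
  by apply: contraNN => /eqP ->; rewrite mul0e.
have N0 : 0 < P N.
  apply: lt_le_trans NB0 _; apply: le_measure; rewrite ?inE//.
rewrite mule_gt0// inve_gt0 ?(gt_eqF N0)// lt_eqF//.
by apply: le_lt_trans (probability_le1 P mN) _; rewrite ltry.
Qed.

End ConditionalLaw.

(** * Identification of the supports *)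

Section SupportIdentification.
Context {R : realType} {d : nat} {Lambda : finType}.
Variables (phi : Lambda -> 'rV[R]_d -> 'rV[R]_d) (K : set 'rV[R]_d).
Hypotheses (hphi : similarity_IFS phi) (hK : is_attractor phi K).
Context {dO : measure_display} {Omega : measurableType dO}.
Variable P : probability Omega R.
Variables (W : Omega -> {set Lambda}) (Wa : seq Lambda -> Omega -> {set Lambda}).
Hypothesis hWa : independent_copies P W Wa.
Implicit Types (S T : set (seq Lambda)) (v : seq Lambda).
Local Notation X := (environment Wa).
Local Notation N := (@survives Lambda).

Lemma reduced_GW_leafless w : nonextinction Wa w ->
  leafless_trees (reduced (GW Wa w)).
Proof. by move=> Nw; apply: reduced_leafless => //; exact: GW_tree_is_tree. Qed.

Lemma measurable_ball_Gprime S (e : R) : 0 < e ->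
  measurable (nonextinction Wa `&` (fun w => reduced (GW Wa w)) @^-1`
    mball leafless_trees (@tree_dist Lambda R) S e).
Proof.
move=> e0; have [n nP] := tree_dist_ltP (Lambda := Lambda) e0.
have -> : nonextinction Wa `&` (fun w => reduced (GW Wa w)) @^-1`
      mball leafless_trees (@tree_dist Lambda R) S e =
    X @^-1` (N `&` [set x | forall k, (k < n)%N -> pattern k (level S k) x]).
  apply/seteqP; split=> w [Nw].
    by move=> [_ /nP Sw]; split=> // k kn; split=> //; exact/esym/Sw.
  move=> Sw; split=> //; split; first exact: reduced_GW_leafless.
  by apply/nP => k kn; have [] := Sw k kn.
apply: (measurable_event hWa); apply: measurableI; first exact: measurable_survives.
apply: (@measurable_forall _ _ (fun k => [set x | (k < n)%N -> pattern k (level S k) x])) => k.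
by apply: measurable_imply => _; exact: measurable_pattern.
Qed.

Lemma measurable_ball_Ginf S (e : R) : 0 < e ->
  measurable (nonextinction Wa `&` GW Wa @^-1`
    mball infinite_trees (@tree_dist Lambda R) S e).
Proof.
move=> e0; have [n nP] := tree_dist_ltP (Lambda := Lambda) e0.
have -> : nonextinction Wa `&` GW Wa @^-1`
      mball infinite_trees (@tree_dist Lambda R) S e =
    X @^-1` (N `&` [set x | forall k, (k < n)%N -> forall v, size v = k -> GW_tree x v <-> S v]).
  apply/seteqP; split=> w [Nw].
    move=> [_ /nP Sw]; split=> // k kn v vk; have := Sw k kn.
    move=> /seteqP[SG GS]; split=> [Gv|Sv]; first by have [] := GS v.
    by have [] := SG v.
  move=> Sw; split=> //; split; first by split=> //; exact: GW_tree_is_tree.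
  apply/nP => k kn; apply/seteqP; split=> v [Sv vk]; split=> //.
    exact: (Sw k kn v vk).2.
  exact: (Sw k kn v vk).1.
apply: (measurable_event hWa); apply: measurableI; first exact: measurable_survives.
apply: (@measurable_forall _ _ (fun k => [set x : env | (k < n)%N ->
  forall v, size v = k -> GW_tree x v <-> S v])) => k.
apply: (@measurable_imply _ _ [set x : env | forall v, size v = k -> GW_tree x v <-> S v]) => _.
apply: (@measurable_forall _ _ (fun v => [set x : env | size v = k -> GW_tree x v <-> S v])) => v.
apply: (@measurable_imply _ _ [set x : env | GW_tree x v <-> S v]) => _.
exact: (measurable_iff _ (measurable_GW_tree v)).
Qed.

(** The ball is open, so its event is the union of those patterns that force the image into it.
    Finite lists [q.2] encode the levels, which keeps the union countable. *)
Lemma measurable_ball_E A (e : R) : nonempty_compacts_in K A ->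
  measurable (nonextinction Wa `&` (fun w => Gamma phi (GW Wa w)) @^-1`
    mball (nonempty_compacts_in K) hausdorff_dist A e).
Proof.
move=> Kc.
pose good (q : nat * seq (seq Lambda)) := forall T, leafless_trees T ->
  level T q.1 = [set` q.2] -> hausdorff_dist A (Gamma phi T) < e.
have GR w : Gamma phi (GW Wa w) = Gamma phi (reduced (GW Wa w)).
  by rewrite Gamma_reduced//; exact: GW_tree_is_tree.
have -> : nonextinction Wa `&` (fun w => Gamma phi (GW Wa w)) @^-1`
      mball (nonempty_compacts_in K) hausdorff_dist A e =
    X @^-1` [set x | exists q, good q /\ pattern q.1 [set` q.2] x].
  apply/seteqP; split=> w.
    move=> [Nw [_]]; rewrite GR => Aw; have Tl := reduced_GW_leafless Nw.
    have [n nP] := hausdorff_Gamma_lt hphi hK Kc Tl Aw.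
    have [l lP] := level_seq (reduced (GW Wa w)) n.
    exists (n, l); split; last by split.
    by move=> T Tl' Tn; apply: nP => //; rewrite lP.
  move=> [q [gq [Nw pq]]]; have Tl := reduced_GW_leafless Nw.
  split=> //; rewrite /preimage /mball /= GR; split; first exact: Gamma_compacts.
  exact: gq.
apply: (measurable_event hWa).
apply: (@measurable_exists _ _ (fun q => [set x | good q /\ pattern q.1 [set` q.2] x])) => q.
have [gq|ngq] := pselect (good q).
  have -> : [set x | good q /\ pattern q.1 [set` q.2] x] = pattern q.1 [set` q.2].
    by apply/seteqP; split=> x => [[]|].
  exact: measurable_pattern.
have -> : [set x | good q /\ pattern q.1 [set` q.2] x] = set0.
  by apply/seteqP; split=> x => [[]|].
exact: measurable0.
Qed.

Lemma Gamma_reduced_charged_closed A : nonempty_compacts_in K A ->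
  (forall e : R, 0 < e -> exists2 S, reduced_charged_trees P W S &
    hausdorff_dist A (Gamma phi S) < e) ->
  (Gamma phi @` reduced_charged_trees P W) A.
Proof.
apply: (Gamma_limit hphi hK) => [S []//|S].
exact: reduced_charged_closed.
Qed.

Lemma Gamma_charged_trees :
  Gamma phi @` reduced_charged_trees P W = Gamma phi @` charged_trees P W.
Proof.
apply/seteqP; split=> _ [S Sch <-].
  by have [T Tch TS] := charged_completion Sch; exists T; rewrite // /Gamma TS.
exists (reduced S); first exact: reduced_charged.
by rewrite Gamma_reduced//; case: Sch => [[]].
Qed.

Lemma sample_charged_trees (U : set Omega) : measurable U -> U `<=` nonextinction Wa ->
  (0 < P U)%E -> exists2 w, U w & charged_trees P W (GW Wa w).
Proof.
move=> mU UN U0; have [w Uw wch] := charged_sample hWa mU U0.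
by exists w => //; apply: charged_GW => //; exact: UN.
Qed.

Lemma supp_E_sub : supp_E P Wa phi K `<=` Gamma phi @` reduced_charged_trees P W.
Proof.
move=> A [Kc Apos]; apply: Gamma_reduced_charged_closed => // e e0.
have mball_e := measurable_ball_E e Kc.
have /(cond_law_gt0 P (measurable_nonextinction hWa) mball_e) pos := Apos e e0.
have [w [Nw [_ Aw]] wch] := sample_charged_trees mball_e (@subIsetl _ _ _) pos.
exists (reduced (GW Wa w)); first exact: reduced_charged.
by rewrite Gamma_reduced//; exact: GW_tree_is_tree.
Qed.

Lemma supp_Gprime_sub : supp_Gprime P Wa `<=` reduced_charged_trees P W.
Proof.
move=> S [Sl Spos]; split=> // v Sv.
(* Within this radius trees agree up to level [(size v).+1], hence on [v] and all its children. *)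
have e0 : (0 : R) < 2^-1 ^+ (size v).+1 by rewrite exprn_gt0// invr_gt0.
have mball_e := measurable_ball_Gprime S e0.
have /(cond_law_gt0 P (measurable_nonextinction hWa) mball_e) pos := Spos _ e0.
have [w [Nw [Tl Sw]] /reduced_charged[_ Tch]] :=
  sample_charged_trees mball_e (@subIsetl _ _ _) pos.
have STlevel := tree_dist_lt_level Sw.
have TSlevel k (kn : (k <= (size v).+1)%N) := esym (STlevel k kn).
have -> : children S v = children (reduced (GW Wa w)) v.
  apply/setP => j; apply/idP/idP => /in_children ?; apply/in_children;
    by [apply: (level_tree STlevel); rewrite ?size_rcons |
        apply: (level_tree TSlevel); rewrite ?size_rcons].
by apply: Tch; apply: (level_tree STlevel).
Qed.

Lemma supp_Ginf_sub : supp_Ginf P Wa `<=` charged_trees P W.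
Proof.
move=> S [Sl Spos]; split=> // v Sv.
have e0 : (0 : R) < 2^-1 ^+ (size v).+1 by rewrite exprn_gt0// invr_gt0.
have mball_e := measurable_ball_Ginf S e0.
have /(cond_law_gt0 P (measurable_nonextinction hWa) mball_e) pos := Spos _ e0.
have [w [Nw [Tl Sw]] [_ Tch]] :=
  sample_charged_trees mball_e (@subIsetl _ _ _) pos.
have STlevel := tree_dist_lt_level Sw.
have TSlevel k (kn : (k <= (size v).+1)%N) := esym (STlevel k kn).
have -> : children S v = children (GW Wa w) v.
  apply/setP => j; apply/idP/idP => /in_children ?; apply/in_children;
    by [apply: (level_tree STlevel); rewrite ?size_rcons |
        apply: (level_tree TSlevel); rewrite ?size_rcons].
by apply: Tch; apply: (level_tree STlevel).
Qed.

(** * Equality of the supports with charged trees when survival has positive probability *)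

Section Survival.
Hypothesis survival : (0 < P (nonextinction Wa))%E.

Lemma supp_Gprime_charged : supp_Gprime P Wa = reduced_charged_trees P W.
Proof.
apply/seteqP; split=> [|S Sch]; first exact: supp_Gprime_sub.
split=> [|e e0]; first exact: Sch.1.
have mball_e := measurable_ball_Gprime S e0.
apply/(cond_law_gt0 P (measurable_nonextinction hWa) mball_e).
have [n nP] := tree_dist_ltP (Lambda := Lambda) e0.
apply: lt_le_trans (pattern_gt0 hWa survival n Sch) _.
apply: le_measure; rewrite ?inE//.
  by apply: (measurable_event hWa); exact: measurable_pattern.
move=> w [Nw Sw]; have Tl := reduced_GW_leafless Nw; split=> //; split=> //.
by apply/nP => k kn; apply: (leafless_level_eq Sch.1 Tl (ltnW kn)); exact/esym/Sw.
Qed.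

Lemma supp_Ginf_charged : supp_Ginf P Wa = charged_trees P W.
Proof.
apply/seteqP; split=> [|S Sch]; first exact: supp_Ginf_sub.
split=> [|e e0]; first exact: Sch.1.
have mball_e := measurable_ball_Ginf S e0.
apply/(cond_law_gt0 P (measurable_nonextinction hWa) mball_e).
have [n nP] := tree_dist_ltP (Lambda := Lambda) e0.
apply: lt_le_trans (agreement_gt0 hWa survival n Sch) _.
apply: le_measure; rewrite ?inE//.
  apply: (measurable_event hWa); apply: measurableI; first exact: measurable_survives.
  exact: measurable_agreement.
move=> w [Nw Sw]; split=> //; split; first by split=> //; exact: GW_tree_is_tree.
apply/nP => k kn; apply/seteqP; split=> v [Sv vk]; split=> //; apply/(Sw v) => //;
  by rewrite vk ltnW.
Qed.

Lemma supp_E_charged : supp_E P Wa phi K = Gamma phi @` reduced_charged_trees P W.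
Proof.
apply/seteqP; split=> [|_ [S Sch <-]]; first exact: supp_E_sub.
have Kc : nonempty_compacts_in K (Gamma phi S) by apply: Gamma_compacts => //; exact: Sch.1.
split=> // e e0.
have mball_e := measurable_ball_E e Kc.
apply/(cond_law_gt0 P (measurable_nonextinction hWa) mball_e).
have [n nP] := hausdorff_Gamma_level hphi hK e0.
apply: lt_le_trans (pattern_gt0 hWa survival n Sch) _.
apply: le_measure; rewrite ?inE//.
  by apply: (measurable_event hWa); exact: measurable_pattern.
move=> w [Nw Sw]; have Tl := reduced_GW_leafless Nw; split=> //.
have GR : Gamma phi (GW Wa w) = Gamma phi (reduced (GW Wa w)).
  by rewrite Gamma_reduced//; exact: GW_tree_is_tree.
rewrite /preimage /mball /= GR; split; first exact: Gamma_compacts.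
by apply: nP => //; exact: Sch.1.
Qed.

End Survival.

(** Levels are finite, so there are countably many patterns and one null set serves them all. *)
Lemma negligible_avoiding (A0 : {set Lambda}) : (1 < #|A0|)%N -> charged P W A0 ->
  P.-negligible [set w | exists n (l : seq (seq Lambda)),
    (0 < P (X @^-1` pattern n [set` l]))%E /\
    (N `&` avoiding (pattern n [set` l])) (X w)].
Proof.
move=> A02 A0ch.
pose F k := if @unpickle (nat * seq (seq Lambda))%type k is Some (n, l)
  then [set w | (0 < P (X @^-1` pattern n [set` l]))%E /\
    (N `&` avoiding (pattern n [set` l])) (X w)] else set0.
apply: (@negligibleS _ _ _ P (\bigcup_k F k)).
  by move=> w [n [l nl]]; exists (pickle (n, l)) => //; rewrite /F pickleK.
apply: negligible_bigcup => k; rewrite /F.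
case: unpickle => [[n l]|]; last exact: negligible_set0.
have mpat := measurable_pattern n [set` l].
have [pos|npos] := pselect (0 < P (X @^-1` pattern n [set` l]))%E; last first.
  by apply: negligibleS (negligible_set0 _) => w [].
exists (X @^-1` (N `&` avoiding (pattern n [set` l]))); split.
- apply: (measurable_event hWa); apply: measurableI; first exact: measurable_survives.
  exact: measurable_avoiding.
- by apply: (avoiding_null hWa (A0 := A0)) => // x [].
- by move=> w [].
Qed.

End SupportIdentification.

Theorem theorem4p10 (R : realType) (d : nat) (Lambda : finType)
    (phi : Lambda -> 'rV[R]_d -> 'rV[R]_d) (K : set 'rV[R]_d)
    (dO : measure_display) (Omega : measurableType dO)
    (P : probability Omega R)
    (W : Omega -> {set Lambda}) (Wa : seq Lambda -> Omega -> {set Lambda})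
    (hphi : similarity_IFS phi) (hK : is_attractor phi K)
    (hW : discrete_rv W) (hWa : independent_copies P W Wa)
    (supercritical : (1 < 'E_P[fun w => #|W w|%:R])%E) :
  [/\ supp_E P Wa phi K = Gamma phi @` supp_Gprime P Wa,
      Gamma phi @` supp_Gprime P Wa = Gamma phi @` supp_Ginf P Wa &
      {ae P, forall w, nonextinction Wa w ->
         supp_E P Wa phi K =
         mclosure (nonempty_compacts_in K) hausdorff_dist
           (descendants phi (reduced (GW Wa w)))}].
Proof.
have mN := measurable_nonextinction hWa.
(* When survival is a null event all three supports are empty, and the almost sure claim holds off
   that event vacuously. *)
have [survival|extinct] := pselect (0 < P (nonextinction Wa))%E; last first.
  have supp0 (T : Type) (D : set T) dist (Y : Omega -> T) :
      (forall x, D x -> measurable (nonextinction Wa `&` Y @^-1` mball D dist x (1 : R))) ->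
      msupport D dist (cond_law P (nonextinction Wa) Y) = set0.
    move=> mball1; apply/seteqP; split=> // x [Dx /(_ 1 ltr01)].
    move=> /(cond_law_gt0 P mN (mball1 _ Dx)) pos; apply: extinct.
    apply: lt_le_trans pos _; apply: le_measure; rewrite ?inE//.
    exact: mball1.
  have Gprime0 : supp_Gprime P Wa = set0.
    by apply: supp0 => S _; exact: (measurable_ball_Gprime hWa S ltr01).
  have Ginf0 : supp_Ginf P Wa = set0.
    by apply: supp0 => S _; exact: (measurable_ball_Ginf hWa S ltr01).
  have E0 : supp_E P Wa phi K = set0.
    by apply: supp0 => A Kc; exact: (measurable_ball_E hphi hK hWa 1 Kc).
  rewrite Gprime0 Ginf0 E0 image_set0; split=> //.
  exists (nonextinction Wa); split=> //.
    by apply/eqP; rewrite eq_le measure_ge0 andbT leNgt; exact/negP.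
  by move=> w /= nw; apply: contrapT => Nw; apply: nw.
rewrite (supp_E_charged hphi hK hWa survival) (supp_Gprime_charged hWa survival).
rewrite (supp_Ginf_charged hWa survival) Gamma_charged_trees; split=> //.
rewrite -Gamma_charged_trees.
have [A0 A02 A0ch] := supercritical_charged hW supercritical.
(* The exceptional samples: some offspring set is uncharged, or the tree survives but misses a
   pattern of positive probability. *)
have [B [mB B0 sB]] := negligibleU (negligible_uncharged hWa)
  (negligible_avoiding hWa A02 A0ch).
exists B; split=> // w nw; apply: sB; apply: contrapT => /not_orP[wch wpat].
apply: nw => Nw.
have {}wch v : charged P W (Wa v w) by apply: contrapT => ?; apply: wch; exists v.
have Tch := reduced_charged (charged_GW Nw wch).
apply/seteqP; split=> A.
(* Density: the pattern of [S] up to level [n] recurs below some node [v]. It includes survival, so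
   [v] lies in the reduced tree, and uniform continuity makes the descendant set at [v] close to
   [Gamma phi S]. *)
- move=> [S Sch <-]; split; first by apply: (Gamma_compacts hphi hK); exact: Sch.1.
  move=> e e0; have [n nP] := hausdorff_Gamma_level hphi hK e0.
  have [l lP] := level_seq S n.
  have [v ev [Nv patv]] : exists2 v, GW Wa w v & pattern n [set` l] (env_shift v (environment Wa w)).
    apply: contrapT => none; apply: wpat; exists n, l; split.
      by rewrite -lP; exact: (pattern_gt0 hWa survival n Sch).
    by split=> // v ev patv; apply: none; exists v.
  have Tv : reduced (GW Wa w) v.
    exact: (reduced_GW_tree (environment Wa w) v).2.
  exists (Gamma phi (subtree (reduced (GW Wa w)) v)); split; last by exists v.
  have Tvl : leafless_trees (subtree (reduced (GW Wa w)) v).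
    by apply: leafless_subtree => //; exact: Tch.1.
  split; first exact: (Gamma_compacts hphi hK).
  apply: nP => //; first exact: Sch.1.
  by rewrite lP -patv reduced_subtree (subtree_GW_tree ev).
(* Conversely, each descendant set is the image of a subtree of a reduced charged tree, which is
   again one, and the set of these images is closed. *)
- move=> [Kc Aapp]; apply: (Gamma_reduced_charged_closed hphi hK) => // e e0.
  have [Y [[_ AY] [v Tv vY]]] := Aapp e e0; rewrite -vY in AY.
  by exists (subtree (reduced (GW Wa w)) v) => //; exact: reduced_charged_subtree.
Qed.
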